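(* Let $G\in \mathrm{C}^2(\mathbb{R})\cap\mathcal{G}_0$. Fix $p_1,p_2\in\mathbb{R}$ with $p_1<p_2$ and $G'(p_1)<0<G'(p_2)$. Let $K_1=\max\{|G'(p)|:\,p\in[p_1,p_2]\}$ and assume further that $$G''(p_1)<0\quad\text{and}\quad G''(p_1)G'(p_2)e^{-K_1}<G''(p_2)G'(p_1)e^{K_1}.$$ Then there is a $1$-periodic potential $V\in\mathrm{Lip}(\mathbb{R})$ such that, if the equation $$\partial_t u^\epsilon=\epsilon\,\partial^2_{xx}u^\epsilon+G(\partial_x u^\epsilon)+V(x/\epsilon),\quad (t,x)\in(0,\infty)\times\mathbb{R},$$ homogenizes, then its effective Hamiltonian $\overline{H}$ is not quasiconvex.
   Context: $\mathrm{C}$, $\mathrm{UC}$, $\mathrm{Lip}$ denote continuous, uniformly continuous and Lipschitz continuous functions. A function $G\in\mathrm{C}(\mathbb{R})$ is coercive if $G(p)\to\infty$ as $p\to\pm\infty$. $\mathcal{G}_0$ is the set of coercive $G\in\mathrm{C}(\mathbb{R})$ such that for every $\sigma\ge0$ and every bounded $V\in\mathrm{Lip}(\mathbb{R})$, the Cauchy problem for $\partial_t u=\sigma^2\partial^2_{xx}u+G(\partial_x u)+V(x)$ on $(0,\infty)\times\mathbb{R}$ is well-posed (in the viscosity sense) in $\mathrm{UC}([0,\infty)\times\mathbb{R})$. The equation displayed in the claim homogenizes if there is a continuous $\overline{H}:\mathbb{R}\to\mathbb{R}$ (the effective Hamiltonian) such that for every $g\in\mathrm{UC}(\mathbb{R})$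 the unique viscosity solution $u^\epsilon$ with $u^\epsilon(0,\cdot)=g$ converges locally uniformly on $[0,\infty)\times\mathbb{R}$ as $\epsilon\to0$ to the unique viscosity solution $\overline{u}$ of $\partial_t\overline{u}=\overline{H}(\partial_x\overline{u})$ with $\overline{u}(0,\cdot)=g$. A function $F:\mathbb{R}\to\mathbb{R}$ is quasiconvex if each sublevel set $\{p:\,F(p)\le\lambda\}$, $\lambda\in\mathbb{R}$, is an interval (possibly empty). *)

(* Defs.v *)
From Stdlib Require Import Reals Lra.
From Coquelicot Require Import Coquelicot.
Open Scope R_scope.

Definition C2 (G : R -> R) : Prop :=
  forall p, ex_derive G p /\ ex_derive (Derive G) p /\
            continuous (Derive (Derive G)) p.

Definition coercive (G : R -> R) : Prop :=
  forall M, exists Rr, forall p, Rr <= Rabs p -> M <= G p.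

Definition Lipschitz (V : R -> R) : Prop :=
  exists L, forall x y, Rabs (V x - V y) <= L * Rabs (x - y).

Definition bounded (V : R -> R) : Prop :=
  exists M, forall x, Rabs (V x) <= M.

Definition unif_cont (g : R -> R) : Prop :=
  forall eta, 0 < eta -> exists d, 0 < d /\
    forall x y, Rabs (x - y) < d -> Rabs (g x - g y) < eta.

Definition UC_half (u : R -> R -> R) : Prop :=
  forall eta, 0 < eta -> exists d, 0 < d /\
    forall t s x y, 0 <= t -> 0 <= s -> Rabs (t - s) < d -> Rabs (x - y) < d ->
      Rabs (u t x - u s y) < eta.

Definition periodic1 (V : R -> R) : Prop := forall x, V (x + 1) = V x.

Definition quasiconvex (F : R -> R) : Prop :=
  forall lam a b c, a <= b -> b <= c -> F a <= lam -> F c <= lam -> F b <= lam.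

Definition d_t (phi : R -> R -> R) (t x : R) : R := Derive (fun s => phi s x) t.
Definition d_x (phi : R -> R -> R) (t x : R) : R := Derive (fun y => phi t y) x.
Definition d_xx (phi : R -> R -> R) (t x : R) : R := Derive (fun y => d_x phi t y) x.

Definition joint_cont (f : R -> R -> R) : Prop :=
  forall t x eps, 0 < eps -> exists d, 0 < d /\
    forall s y, Rabs (s - t) < d -> Rabs (y - x) < d -> Rabs (f s y - f t x) < eps.

Definition test_fun (phi : R -> R -> R) : Prop :=
  (forall t x, ex_derive (fun s => phi s x) t /\ ex_derive (fun y => phi t y) x /\
               ex_derive (fun y => d_x phi t y) x) /\
  joint_cont phi /\ joint_cont (d_t phi) /\ joint_cont (d_x phi) /\ joint_cont (d_xx phi).

Definition loc_max_at (w : R -> R -> R) (t0 x0 : R) : Prop :=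
  exists r, 0 < r /\ forall t x, 0 < t -> Rabs (t - t0) < r -> Rabs (x - x0) < r ->
    w t x <= w t0 x0.

Definition loc_min_at (w : R -> R -> R) (t0 x0 : R) : Prop :=
  exists r, 0 < r /\ forall t x, 0 < t -> Rabs (t - t0) < r -> Rabs (x - x0) < r ->
    w t0 x0 <= w t x.

Definition visc_sub (a : R) (H : R -> R -> R) (u : R -> R -> R) : Prop :=
  forall phi t0 x0, test_fun phi -> 0 < t0 ->
    loc_max_at (fun t x => u t x - phi t x) t0 x0 ->
    d_t phi t0 x0 <= a * d_xx phi t0 x0 + H x0 (d_x phi t0 x0).

Definition visc_super (a : R) (H : R -> R -> R) (u : R -> R -> R) : Prop :=
  forall phi t0 x0, test_fun phi -> 0 < t0 ->
    loc_min_at (fun t x => u t x - phi t x) t0 x0 ->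
    a * d_xx phi t0 x0 + H x0 (d_x phi t0 x0) <= d_t phi t0 x0.

Definition UC_visc_sol (a : R) (H : R -> R -> R) (g : R -> R) (u : R -> R -> R) : Prop :=
  UC_half u /\ visc_sub a H u /\ visc_super a H u /\ forall x, u 0 x = g x.

Definition well_posed (a : R) (H : R -> R -> R) : Prop :=
  forall g, unif_cont g ->
    (exists u, UC_visc_sol a H g u) /\
    (forall u1 u2, UC_visc_sol a H g u1 -> UC_visc_sol a H g u2 ->
       forall t x, 0 <= t -> u1 t x = u2 t x).

Definition G0 (G : R -> R) : Prop :=
  continuity G /\ coercive G /\
  forall sigma V, 0 <= sigma -> Lipschitz V -> bounded V ->
    well_posed (sigma ^ 2) (fun x p => G p + V x).

Definition effective_hamiltonian (G V : R -> R) (Hbar : R -> R) : Prop :=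
  continuity Hbar /\
  forall g, unif_cont g ->
    exists ubar, UC_visc_sol 0 (fun _ p => Hbar p) g ubar /\
    forall u : R -> R -> R -> R,
      (forall eps, 0 < eps -> UC_visc_sol eps (fun x p => G p + V (x / eps)) g (u eps)) ->
      forall T Rr eta, 0 < eta -> exists d, 0 < d /\
        forall eps t x, 0 < eps -> eps < d -> 0 <= t -> t <= T -> Rabs x <= Rr ->
          Rabs (u eps t x - ubar t x) < eta.

Definition homogenizes (G V : R -> R) : Prop :=
  exists Hbar, effective_hamiltonian G V Hbar.

(* Main.v *)
Require Import Defs.
From Stdlib Require Import Reals ZArith Lra Lia Psatz.
From Stdlib Require Import FunctionalExtensionality ClassicalEpsilon.
From Coquelicot Require Import Coquelicot.
Open Scope R_scope.

(** If [f] is 1-periodic and [f' + G(f) + V = lam], then [Hbar] takes the value [lam] at the mean of [f]; one-sided inequalities for [f' + G(f) + V] give one-sided bounds for [Hbar]. So choose [f] first and set [V = - f' - G(f)], which makes [Hbar >= 0] at the mean of [f]. If the mean of [G'(f)] over a period is [0], the linearized equation [phi' + G'(f) phi = 0] has a positive periodic solution, and a second-order correction turns [f + s phi] into a function with [g' + G(g) + V < 0] for all small [s <> 0], of either sign, as soon as the integral of [G''(f) phi] is negative. Then [Hbar] is negative on both sides of the mean of [f], hence not quasiconvex. A profile [f] that is close to [p1] or to [p2] most of the time meets both integral conditions: [|G'| <= K1] on [[p1, p2]] gives [exp (- K1) <= phi <= exp K1], and the hypothesis on [p1, p2, K1] is what the worst case of these bounds requires. *)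

(** * Comparison with smooth sub- and supersolutions *)

(** The two integral conditions are coupled, because [phi] itself depends on [f]. They are decoupled
    by majorizing [E(f) phi], with [E] the second derivative of [G], by [k0(f)], where [k0 p] is the
    larger of [E p * exp (- K1)] and [E p * exp K1]. Since [D(f)], with [D] the first derivative,
    must have mean zero, any multiple [mu * D(f)] may be added to the integrand without changing its
    integral; the hypothesis on [p1], [p2], [K1] is what provides a [mu] for which [k0 + mu * D] is
    negative at both endpoints. The share of the period spent near each endpoint is dictated by the
    mean-zero condition, but with this [mu] it no longer affects the sign. On the viscosity side
    only smooth comparison functions occur, namely rescaled primitives of periodic correctors. Hence
    no doubling of variables: a penalized maximum of the difference is enough. *)

Lemma continuous_eps (f : R -> R) (x : R) :
  continuous f x ->
  forall e, 0 < e -> exists d, 0 < d /\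
    forall y, Rabs (y - x) < d -> Rabs (f y - f x) < e.
Proof.
  intros Hf e He.
  destruct (proj1 (filterlim_locally f (f x)) Hf (mkposreal e He)) as [d Hd].
  exists d; split; [apply cond_pos|].
  intros y Hy; exact (Hd y Hy).
Qed.

Lemma eps_continuous (f : R -> R) (x : R) :
  (forall e, 0 < e -> exists d, 0 < d /\
    forall y, Rabs (y - x) < d -> Rabs (f y - f x) < e) ->
  continuous f x.
Proof.
  intros H; apply filterlim_locally; intros e.
  destruct (H e (cond_pos e)) as [d [Hd Hy]].
  exists (mkposreal d Hd); intros y By; apply (Hy y By).
Qed.

Lemma continuous_continuity_pt (f : R -> R) (x : R) :
  continuous f x -> continuity_pt f x.
Proof. apply continuity_pt_filterlim. Qed.

Lemma is_derive_continuous (f : R -> R) (x l : R) :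
  is_derive f x l -> continuous f x.
Proof. intros H; apply (ex_derive_continuous (V := R_NormedModule) f x); exists l; exact H. Qed.

Lemma joint_cont_add (A B : R -> R) :
  (forall t, continuous A t) -> (forall x, continuous B x) ->
  joint_cont (fun t x => A t + B x).
Proof.
  intros HA HB t x e He.
  destruct (continuous_eps A t (HA t) (e / 2)) as [d1 [Hd1 H1]]; [lra|].
  destruct (continuous_eps B x (HB x) (e / 2)) as [d2 [Hd2 H2]]; [lra|].
  exists (Rmin d1 d2); split; [now apply Rmin_glb_lt|].
  intros s y Hs Hy.
  specialize (H1 s (Rlt_le_trans _ _ _ Hs (Rmin_l _ _))).
  specialize (H2 y (Rlt_le_trans _ _ _ Hy (Rmin_r _ _))).
  replace (A s + B y - (A t + B x)) with ((A s - A t) + (B y - B x)) by ring.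
  eapply Rle_lt_trans; [apply Rabs_triang|lra].
Qed.

Section SeparableTest.

Variables A A' B B' B'' : R -> R.
Hypothesis dA : forall t, is_derive A t (A' t).
Hypothesis cA' : forall t, continuous A' t.
Hypothesis dB : forall x, is_derive B x (B' x).
Hypothesis dB' : forall x, is_derive B' x (B'' x).
Hypothesis cB'' : forall x, continuous B'' x.

Lemma is_derive_add_t (t x : R) : is_derive (fun s => A s + B x) t (A' t).
Proof.
  replace (A' t) with (A' t + 0) by ring.
  apply (is_derive_plus (V := R_NormedModule) A (fun _ => B x)); [apply dA|].
  apply (is_derive_const (V := R_NormedModule)).
Qed.

Lemma is_derive_add_x (t x : R) : is_derive (fun y => A t + B y) x (B' x).
Proof.
  replace (B' x) with (0 + B' x) by ring.
  apply (is_derive_plus (V := R_NormedModule) (fun _ => A t) B); [|apply dB].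
  apply (is_derive_const (V := R_NormedModule)).
Qed.

Lemma d_t_add : d_t (fun t x => A t + B x) = fun t _ => A' t.
Proof.
  apply functional_extensionality; intros t; apply functional_extensionality; intros x.
  apply is_derive_unique, is_derive_add_t.
Qed.

Lemma d_x_add : d_x (fun t x => A t + B x) = fun _ x => B' x.
Proof.
  apply functional_extensionality; intros t; apply functional_extensionality; intros x.
  apply is_derive_unique, is_derive_add_x.
Qed.

Lemma d_xx_add : d_xx (fun t x => A t + B x) = fun _ x => B'' x.
Proof.
  unfold d_xx; rewrite d_x_add.
  apply functional_extensionality; intros t; apply functional_extensionality; intros x.
  apply is_derive_unique, dB'.
Qed.

Lemma joint_cont_t (f : R -> R) :
  (forall t, continuous f t) -> joint_cont (fun t _ => f t).
Proof.
  intros Hf t x e He; destruct (continuous_eps f t (Hf t) e He) as [d [Hd H]].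
  exists d; split; auto.
Qed.

Lemma joint_cont_x (f : R -> R) :
  (forall x, continuous f x) -> joint_cont (fun _ x => f x).
Proof.
  intros Hf t x e He; destruct (continuous_eps f x (Hf x) e He) as [d [Hd H]].
  exists d; split; auto.
Qed.

(** The comparison argument tests only with separable functions, for which every joint continuity
    requirement reduces to continuity in one variable. *)
Lemma test_fun_add : test_fun (fun t x => A t + B x).
Proof.
  split; [|split; [|split; [|split]]].
  - intros t x; split; [|split].
    + eexists; apply is_derive_add_t.
    + eexists; apply is_derive_add_x.
    + rewrite d_x_add; eexists; apply dB'.
  - apply joint_cont_add; intros y; eapply is_derive_continuous; [apply dA|apply dB].
  - rewrite d_t_add; now apply joint_cont_t.
  - rewrite d_x_add; apply joint_cont_x; intros y; eapply is_derive_continuous, dB'.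
  - rewrite d_xx_add; now apply joint_cont_x.
Qed.

End SeparableTest.

(** Let [d] be the modulus of [u] for oscillation 1. Time is crossed in steps of length [d / 2],
    each changing [u] by at most 1, and at most [1 + 2 t / d] steps are needed, whatever [x] is. *)
Lemma UC_half_linear_growth (u : R -> R -> R) :
  UC_half u ->
  exists C, 0 <= C /\ forall t x, 0 <= t -> Rabs (u t x - u 0 x) <= C + C * t.
Proof.
  intros Hu; destruct (Hu 1 Rlt_0_1) as [d [Hd H]].
  assert (Hn : forall n t x, 0 <= t <= INR n * (d / 2) -> Rabs (u t x - u 0 x) <= INR n).
  { induction n as [|n IH]; intros t x Ht.
    - simpl in Ht; replace t with 0 by lra.
      rewrite Rminus_eq_0, Rabs_R0; simpl; lra.
    - rewrite S_INR in *.
      destruct (Rle_dec t (INR n * (d / 2))) as [Hle|Hgt].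
      + specialize (IH t x); lra.
      + assert (Hs : 0 <= INR n * (d / 2)).
        { apply Rmult_le_pos; [apply pos_INR|lra]. }
        specialize (IH (INR n * (d / 2)) x ltac:(lra)).
        assert (H1 : Rabs (u t x - u (INR n * (d / 2)) x) < 1).
        { apply H; try lra.
          - rewrite Rabs_pos_eq; lra.
          - rewrite Rminus_eq_0, Rabs_R0; lra. }
        replace (u t x - u 0 x) with
          ((u t x - u (INR n * (d / 2)) x) + (u (INR n * (d / 2)) x - u 0 x)) by ring.
        eapply Rle_trans; [apply Rabs_triang|lra]. }
  assert (Hd2 : 0 < 2 / d) by (apply Rdiv_lt_0_compat; lra).
  exists (1 + 2 / d); split; [lra|].
  intros t x Ht.
  assert (Htd : 0 <= t * (2 / d)) by (apply Rmult_le_pos; lra).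
  destruct (archimed (t * (2 / d))) as [Hu1 Hu2].
  assert (Hz : (0 <= up (t * (2 / d)))%Z) by (apply le_IZR; lra).
  specialize (Hn (Z.to_nat (up (t * (2 / d)))) t x).
  rewrite INR_IZR_INZ, Z2Nat.id in Hn by exact Hz.
  assert (Hle : t <= IZR (up (t * (2 / d))) * (d / 2)).
  { replace t with (t * (2 / d) * (d / 2)) at 1 by (field; lra).
    apply Rmult_le_compat_r; lra. }
  specialize (Hn ltac:(lra)). lra.
Qed.

(** The maximum is taken first in [x], then in [t]. The maximizer [y t] need not depend continuously
    on [t], but the maximal value does, because the continuity in time is uniform in [x]. *)
Lemma rectangle_max (w : R -> R -> R) (T X : R) :
  0 <= T -> 0 <= X ->
  (forall t x, continuous (w t) x) ->
  (forall t e, 0 < e -> exists d, 0 < d /\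
     forall s x, Rabs (s - t) < d -> Rabs (w s x - w t x) < e) ->
  exists t0 x0, 0 <= t0 <= T /\
    forall t x, 0 <= t <= T -> - X <= x <= X -> w t x <= w t0 x0.
Proof.
  intros HT HX Hx Ht.
  assert (Hm : forall t, exists y, - X <= y <= X /\
                 forall x, - X <= x <= X -> w t x <= w t y).
  { intros t.
    destruct (continuity_ab_maj (w t) (- X) X) as [y [Hy Hy']]; [lra| |].
    - intros; apply continuous_continuity_pt, Hx.
    - exists y; auto. }
  pose (y t := proj1_sig (constructive_indefinite_description _ (Hm t))).
  assert (Hy : forall t, - X <= y t <= X /\
                 forall x, - X <= x <= X -> w t x <= w t (y t)).
  { intros t; unfold y; apply (proj2_sig (constructive_indefinite_description _ (Hm t))). }
  destruct (continuity_ab_maj (fun t => w t (y t)) 0 T HT) as [t0 [H1 H2]].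
  - intros t _; apply continuous_continuity_pt, eps_continuous; intros e He.
    destruct (Ht t e He) as [d [Hd H]]; exists d; split; [exact Hd|].
    intros s Hs.
    pose proof (H s (y t) Hs) as Ha; pose proof (H s (y s) Hs) as Hb.
    destruct (Hy t) as [Ht1 Ht2]; destruct (Hy s) as [Hs1 Hs2].
    specialize (Ht2 _ Hs1); specialize (Hs2 _ Ht1).
    apply Rabs_def2 in Ha; apply Rabs_def2 in Hb; apply Rabs_def1; lra.
  - exists t0, (y t0); split; [exact H2|].
    intros t x Ht' Hx'.
    eapply Rle_trans; [apply Hy, Hx'|apply (H1 t Ht')].
Qed.

(** The penalty must grow like [Rabs x] to beat a bounded excess at infinity, while its first two
    derivatives stay bounded, so that a small multiple of it hardly changes the equation. *)
Lemma penalty_exists :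
  exists psi psi' psi'' : R -> R,
    (forall x, is_derive psi x (psi' x)) /\
    (forall x, is_derive psi' x (psi'' x)) /\
    (forall x, continuous psi'' x) /\
    (forall x, Rabs (psi' x) <= 1) /\
    (forall x, psi'' x <= 1) /\
    (forall x, Rabs x <= psi x).
Proof.
  exists (fun x => sqrt (1 + x * x)), (fun x => x / sqrt (1 + x * x)),
    (fun x => / (sqrt (1 + x * x) * (1 + x * x))).
  assert (Hp : forall x, 0 < 1 + x * x) by (intros; nra).
  assert (Hq : forall x, 0 < sqrt (1 + x * x)) by (intros; now apply sqrt_lt_R0).
  assert (Hs : forall x, sqrt (1 + x * x) * sqrt (1 + x * x) = 1 + x * x).
  { intros x; apply sqrt_sqrt; specialize (Hp x); lra. }
  assert (Ha : forall x, Rabs x <= sqrt (1 + x * x)).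
  { intros x; rewrite <- sqrt_Rsqr_abs; apply sqrt_le_1_alt; unfold Rsqr; lra. }
  assert (H1 : forall x, 1 <= sqrt (1 + x * x)).
  { intros x; rewrite <- sqrt_1 at 1; apply sqrt_le_1_alt; nra. }
  split; [|split; [|split; [|split; [|split]]]].
  - intros x; specialize (Hp x); specialize (Hq x); auto_derive; [lra|field; lra].
  - intros x; specialize (Hp x); specialize (Hq x); specialize (Hs x).
    auto_derive; [repeat split; lra|].
    set (r := sqrt (1 + x * x)) in *.
    rewrite <- Hs. field_simplify_eq; [|lra]. simpl in x. nra.
  - intros x; specialize (Hp x); specialize (Hq x).
    apply (ex_derive_continuous (V := R_NormedModule)); auto_derive; split; [lra|split; [|exact I]].
    apply Rgt_not_eq, Rmult_lt_0_compat; lra.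
  - intros x; unfold Rdiv; rewrite Rabs_mult, (Rabs_pos_eq (/ _)).
    + apply (Rmult_le_reg_r (sqrt (1 + x * x))); [apply Hq|].
      rewrite Rmult_assoc, Rinv_l, Rmult_1_r, Rmult_1_l; [apply Ha|].
      apply Rgt_not_eq, Hq.
    + left; apply Rinv_0_lt_compat, Hq.
  - intros x; apply (Rle_trans _ (/ 1)); [apply Rinv_le_contravar; [lra|]|rewrite Rinv_1; lra].
    specialize (H1 x); nra.
  - exact Ha.
Qed.

(* Since [u] is uniformly continuous in time, [u t x - u 0 x] grows at most linearly in [t] uniformly in [x], so the penalties [e * t^2] and [e * sqrt (1 + x^2)] force a maximum to exist although [u] is unbounded. *)
Lemma visc_sub_le (a : R) (G W : R -> R) (u : R -> R -> R) (b b' b'' : R -> R) (lam M : R) :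
  0 <= a -> (forall p, continuous G p) ->
  UC_half u -> visc_sub a (fun x p => G p + W x) u ->
  (forall x, is_derive b x (b' x)) -> (forall x, is_derive b' x (b'' x)) ->
  (forall x, continuous b'' x) -> (forall x, Rabs (b' x) <= M) ->
  (forall x, a * b'' x + G (b' x) + W x <= lam) ->
  (forall x, u 0 x <= b x) ->
  forall t x, 0 <= t -> u t x <= lam * t + b x.
Proof.
  intros Ha HG Hu Hsub Db Db' Cb'' HM Hlam H0 t1 x1 Ht1.
  destruct penalty_exists as (psi & psi' & psi'' & Dp & Dp' & Cp & B1 & B2 & B0).
  apply Rnot_lt_le; intros Hlt.
  set (gap := u t1 x1 - (lam * t1 + b x1)).
  assert (Hgap : 0 < gap) by (unfold gap; lra).
  (* The test function gets the extra time slope [2 * de]: one [de] pays for the variation of [G]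
     under the penalty, the other for the added diffusion [a * e]. Half of the gap is reserved for
     this slope, half for the penalties. *)
  assert (Hde : exists de, 0 < de /\ 2 * de * t1 < gap / 2).
  { exists (gap / (8 * (t1 + 1))); split; [apply Rdiv_lt_0_compat; lra|].
    replace (2 * (gap / (8 * (t1 + 1))) * t1) with (gap / 4 * (t1 / (t1 + 1))) by (field; lra).
    assert (t1 / (t1 + 1) < 1) by (apply Rlt_div_l; lra). nra. }
  destruct Hde as [de [Hde0 Hde1]].
  (* Both [b'] and its penalized version take values in this interval once [e < 1]. *)
  destruct (Heine_cor2 (f := G) (a := - M - 1) (b := M + 1)
              (fun x _ => continuous_continuity_pt _ _ (HG x)) (mkposreal de Hde0))
    as [d Hd]; simpl in Hd.
  assert (He : exists e, 0 < e /\ e < 1 /\ e < d /\ a * e < de /\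
                         e * (t1 * t1 + psi x1) < gap / 2).
  { pose proof (cond_pos d) as Hd0.
    pose proof (B0 x1) as Hp1; pose proof (Rabs_pos x1) as Hp2.
    exists (Rmin (Rmin (1 / 2) (d / 2))
              (Rmin (de / (2 * (a + 1))) (gap / (4 * (t1 * t1 + psi x1 + 1))))).
    set (e := Rmin _ _).
    assert (E1 : e <= 1 / 2) by (eapply Rle_trans; [apply Rmin_l|apply Rmin_l]).
    assert (E2 : e <= d / 2) by (eapply Rle_trans; [apply Rmin_l|apply Rmin_r]).
    assert (E3 : e <= de / (2 * (a + 1))) by (eapply Rle_trans; [apply Rmin_r|apply Rmin_l]).
    assert (E4 : e <= gap / (4 * (t1 * t1 + psi x1 + 1)))
      by (eapply Rle_trans; [apply Rmin_r|apply Rmin_r]).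
    assert (E0 : 0 < e).
    { apply Rmin_glb_lt; apply Rmin_glb_lt; try lra; apply Rdiv_lt_0_compat; nra. }
    apply Rle_div_r in E3; [|lra]. apply Rle_div_r in E4; [|nra].
    repeat split; try lra; nra. }
  destruct He as (e & E0 & E1 & E2 & E3 & E4).
  destruct (UC_half_linear_growth u Hu) as [C [HC HCu]].
  set (A := fun t => (lam + 2 * de) * t + e * (t * t)).
  set (A' := fun t => (lam + 2 * de) + 2 * e * t).
  set (B := fun x => b x + e * psi x).
  set (B' := fun x => b' x + e * psi' x).
  set (B'' := fun x => b'' x + e * psi'' x).
  assert (DA : forall t, is_derive A t (A' t)).
  { intros t; unfold A, A'; auto_derive; [exact I|ring]. }
  assert (CA : forall t, continuous A' t).
  { intros t; apply (ex_derive_continuous (V := R_NormedModule)); unfold A'; auto_derive; exact I. }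
  assert (DB : forall x, is_derive B x (B' x)).
  { intros x; apply (is_derive_plus (V := R_NormedModule)); [apply Db|].
    apply (is_derive_scal psi), Dp. }
  assert (DB' : forall x, is_derive B' x (B'' x)).
  { intros x; apply (is_derive_plus (V := R_NormedModule)); [apply Db'|].
    apply (is_derive_scal psi'), Dp'. }
  assert (CB : forall x, continuous B'' x).
  { intros x; apply (continuous_plus (V := R_NormedModule)); [apply Cb''|].
    apply (continuous_scal_r (V := R_NormedModule) e psi''), Cp. }
  (* The modulus of [u] is known only for nonnegative times; freezing [u] at time 0 before that
     gives continuity for all real [t], as [rectangle_max] asks. *)
  set (w := fun t x => u (Rmax 0 t) x - (A t + B x)).
  set (K := Rabs (C - lam - 2 * de)).
  assert (HK : 0 <= K) by apply Rabs_pos.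
  assert (HK' : C - lam - 2 * de <= K) by apply Rle_abs.
  assert (Hw : forall t x, 0 <= t -> w t x <= C + K * t - e * (t * t) - e * Rabs x).
  { intros t x Ht; unfold w, A, B; rewrite Rmax_right by exact Ht.
    specialize (HCu t x Ht); specialize (H0 x); specialize (B0 x).
    apply Rabs_le_between in HCu. nra. }
  (* Past [T] the term [e * t^2] dominates [C + K * t] (the [+ 1] ensures [C <= C * t]); past [X]
     the term [e * Rabs x] dominates [C + K * T]. Adding [t1] and [Rabs x1] keeps the point of
     violation inside the rectangle. *)
  set (T := (K + C) / e + 1 + t1).
  set (X := (C + K * T) / e + Rabs x1).
  assert (HKC : 0 <= (K + C) / e) by (apply Rdiv_le_0_compat; lra).
  assert (HT : 0 <= T) by (unfold T; lra).
  assert (HCT : 0 <= (C + K * T) / e) by (apply Rdiv_le_0_compat; nra).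
  assert (HX : 0 <= X) by (unfold X; pose proof (Rabs_pos x1); lra).
  assert (Hout : forall t x, 0 <= t -> (T <= t \/ X <= Rabs x) -> w t x <= 0).
  { intros t x Ht Hor; eapply Rle_trans; [now apply Hw|].
    pose proof (Rabs_pos x) as Hx0.
    destruct (Rle_dec T t) as [HTt|HTt].
    - assert (H1 : (K + C) / e + 1 <= t) by (unfold T in HTt; lra).
      assert (H2 : K + C <= t * e).
      { apply Rle_div_l; lra. }
      nra.
    - destruct Hor as [|HXx]; [lra|].
      assert (H2 : C + K * T <= Rabs x * e).
      { pose proof (Rabs_pos x1); unfold X in HXx. apply Rle_div_l; lra. }
      nra. }
  assert (Hpos : 0 < w t1 x1).
  { unfold w, A, B; rewrite Rmax_right by exact Ht1. unfold gap in *. nra. }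
  destruct (rectangle_max w T X HT HX) as (t0 & x0 & Ht0 & Hmax).
  { intros t x; unfold w.
    apply (continuous_minus (V := R_NormedModule) (fun y => u (Rmax 0 t) y) (fun y => A t + B y)).
    - apply eps_continuous; intros eta Heta.
      destruct (Hu eta Heta) as [r [Hr H]]; exists r; split; [exact Hr|].
      intros y Hy; apply H; try apply Rmax_l; [|exact Hy].
      rewrite Rminus_eq_0, Rabs_R0; exact Hr.
    - apply (continuous_plus (V := R_NormedModule) (fun _ => A t) B);
        [apply continuous_const|eapply is_derive_continuous, DB]. }
  { intros t eta Heta.
    destruct (Hu (eta / 2)) as [r [Hr H]]; [lra|].
    destruct (continuous_eps A t (is_derive_continuous _ _ _ (DA t)) (eta / 2))
      as [r' [Hr' H']]; [lra|].
    exists (Rmin r r'); split; [now apply Rmin_glb_lt|].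
    intros s x Hs.
    specialize (H' s (Rlt_le_trans _ _ _ Hs (Rmin_r _ _))).
    specialize (H (Rmax 0 s) (Rmax 0 t) x x (Rmax_l _ _) (Rmax_l _ _)).
    assert (Hst : Rabs (Rmax 0 s - Rmax 0 t) < r).
    { eapply Rle_lt_trans; [|eapply Rlt_le_trans; [exact Hs|apply Rmin_l]].
      unfold Rmax; destruct (Rle_dec 0 s), (Rle_dec 0 t);
        unfold Rabs; repeat destruct Rcase_abs; lra. }
    rewrite Rminus_eq_0, Rabs_R0 in H. specialize (H Hst Hr).
    unfold w; apply Rabs_def2 in H; apply Rabs_def2 in H'; apply Rabs_def1; lra. }
  assert (Hglob : forall t x, 0 <= t -> w t x <= w t0 x0).
  { assert (Hin : w t1 x1 <= w t0 x0).
    { apply Hmax; [unfold T; lra|].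
      pose proof (Rabs_le_between x1 X) as Hb; apply Hb; unfold X; lra. }
    intros t x Ht.
    destruct (Rle_dec T t) as [h|h]; [specialize (Hout t x Ht (or_introl h)); lra|].
    destruct (Rle_dec X (Rabs x)) as [k|k]; [specialize (Hout t x Ht (or_intror k)); lra|].
    apply Hmax; [lra|]. apply Rabs_le_between; lra. }
  (* The viscosity inequality holds only at positive times. At time 0 the ordering of the initial
     data would give [w <= 0], against the positive value at [(t1, x1)]. *)
  assert (Ht0' : 0 < t0).
  { destruct (Rle_lt_or_eq_dec 0 t0) as [h|h]; [lra|exact h|].
    exfalso. specialize (Hglob t1 x1 Ht1).
    rewrite <- h in Hglob; unfold w at 2, A, B in Hglob.
    rewrite Rmax_right in Hglob by lra.
    specialize (H0 x0); specialize (B0 x0); pose proof (Rabs_pos x0). nra. }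
  assert (Hloc : loc_max_at (fun t x => u t x - (A t + B x)) t0 x0).
  { exists 1; split; [lra|]; intros t x Ht _ _.
    specialize (Hglob t x ltac:(lra)); unfold w in Hglob.
    now rewrite !Rmax_right in Hglob by lra. }
  specialize (Hsub _ t0 x0 (test_fun_add A A' B B' B'' DA CA DB DB' CB) Ht0' Hloc).
  rewrite (d_t_add A A' B DA), (d_xx_add A B B' B'' DB DB'), (d_x_add A B B' DB) in Hsub.
  assert (HGd : Rabs (G (B' x0) - G (b' x0)) < de).
  { specialize (HM x0); specialize (B1 x0).
    apply Rabs_le_between in HM; apply Rabs_le_between in B1.
    apply Hd; unfold B'; try nra.
    apply Rabs_def1; nra. }
  apply Rabs_def2 in HGd.
  specialize (Hlam x0); specialize (B2 x0).
  unfold A', B'' in Hsub.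
  assert (a * (e * psi'' x0) <= a * e) by (apply Rmult_le_compat_l; nra).
  assert (0 < e * t0) by nra. destruct HGd. nra.
Qed.

(** * Reflection [u -> - u] between supersolutions and subsolutions *)

Lemma joint_cont_opp (f : R -> R -> R) :
  joint_cont f -> joint_cont (fun t x => - f t x).
Proof.
  intros Hf t x e He; destruct (Hf t x e He) as [d [Hd H]].
  exists d; split; [exact Hd|]; intros s y Hs Hy.
  replace (- f s y - - f t x) with (- (f s y - f t x)) by ring.
  rewrite Rabs_Ropp; auto.
Qed.

Lemma d_t_opp (phi : R -> R -> R) : d_t (fun t x => - phi t x) = fun t x => - d_t phi t x.
Proof.
  apply functional_extensionality; intros t; apply functional_extensionality; intros x.
  apply Derive_opp.
Qed.

Lemma d_x_opp (phi : R -> R -> R) : d_x (fun t x => - phi t x) = fun t x => - d_x phi t x.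
Proof.
  apply functional_extensionality; intros t; apply functional_extensionality; intros x.
  apply Derive_opp.
Qed.

Lemma d_xx_opp (phi : R -> R -> R) : d_xx (fun t x => - phi t x) = fun t x => - d_xx phi t x.
Proof.
  unfold d_xx; rewrite d_x_opp.
  apply functional_extensionality; intros t; apply functional_extensionality; intros x.
  apply Derive_opp.
Qed.

Lemma test_fun_opp (phi : R -> R -> R) : test_fun phi -> test_fun (fun t x => - phi t x).
Proof.
  intros (H1 & H2 & H3 & H4 & H5).
  split; [|split; [|split; [|split]]].
  - intros t x; destruct (H1 t x) as (Ha & Hb & Hc); split; [|split].
    + apply (ex_derive_opp (V := R_NormedModule)), Ha.
    + apply (ex_derive_opp (V := R_NormedModule)), Hb.
    + rewrite d_x_opp; apply (ex_derive_opp (V := R_NormedModule)), Hc.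
  - now apply joint_cont_opp.
  - rewrite d_t_opp; now apply joint_cont_opp.
  - rewrite d_x_opp; now apply joint_cont_opp.
  - rewrite d_xx_opp; now apply joint_cont_opp.
Qed.

(** The reflected Hamiltonian [- H x (- p)] keeps the form [G p + W x], with [G] replaced by
    [- G (- p)] and [W] by [- W]; the lower comparison thus follows from the upper one. *)
Lemma visc_super_opp (a : R) (H : R -> R -> R) (u : R -> R -> R) :
  visc_super a H u -> visc_sub a (fun x p => - H x (- p)) (fun t x => - u t x).
Proof.
  intros Hu phi t0 x0 Hphi Ht0 [r [Hr Hmax]].
  specialize (Hu _ t0 x0 (test_fun_opp phi Hphi) Ht0).
  rewrite d_t_opp, d_x_opp, d_xx_opp in Hu.
  assert (Hmin : loc_min_at (fun t x => u t x - - phi t x) t0 x0).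
  { exists r; split; [exact Hr|]; intros t x Ht Hs Hx.
    specialize (Hmax t x Ht Hs Hx); simpl in Hmax; lra. }
  specialize (Hu Hmin); lra.
Qed.

Lemma UC_half_opp (u : R -> R -> R) : UC_half u -> UC_half (fun t x => - u t x).
Proof.
  intros Hu eta Heta; destruct (Hu eta Heta) as [d [Hd H]].
  exists d; split; [exact Hd|]; intros t s x y Ht Hs Hts Hxy.
  replace (- u t x - - u s y) with (- (u t x - u s y)) by ring.
  rewrite Rabs_Ropp; auto.
Qed.

Lemma visc_super_ge (a : R) (G W : R -> R) (u : R -> R -> R) (b b' b'' : R -> R) (lam M : R) :
  0 <= a -> (forall p, continuous G p) ->
  UC_half u -> visc_super a (fun x p => G p + W x) u ->
  (forall x, is_derive b x (b' x)) -> (forall x, is_derive b' x (b'' x)) ->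
  (forall x, continuous b'' x) -> (forall x, Rabs (b' x) <= M) ->
  (forall x, lam <= a * b'' x + G (b' x) + W x) ->
  (forall x, b x <= u 0 x) ->
  forall t x, 0 <= t -> lam * t + b x <= u t x.
Proof.
  intros Ha HG Hu Hsup Db Db' Cb HM Hlam H0 t x Ht.
  assert (Hle : - u t x <= - lam * t + - b x); [|lra].
  apply (visc_sub_le a (fun p => - G (- p)) (fun y => - W y) (fun t x => - u t x)
           (fun y => - b y) (fun y => - b' y) (fun y => - b'' y) (- lam) M); auto.
  - intros p; apply (continuous_opp (V := R_NormedModule)).
    apply (continuous_comp Ropp G); [|apply HG].
    apply (continuous_opp (V := R_NormedModule)), continuous_id.
  - now apply UC_half_opp.
  - intros phi t0 x0 Hphi Ht0 Hmax.
    pose proof (visc_super_opp _ _ _ Hsup phi t0 x0 Hphi Ht0 Hmax) as Hh; simpl in Hh; lra.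
  - intros y; apply (is_derive_opp (V := R_NormedModule)), Db.
  - intros y; apply (is_derive_opp (V := R_NormedModule)), Db'.
  - intros y; apply (continuous_opp (V := R_NormedModule)), Cb.
  - intros y; rewrite Rabs_Ropp; apply HM.
  - intros y; specialize (Hlam y); rewrite Ropp_involutive; lra.
  - intros y; specialize (H0 y); lra.
Qed.

(** * Periodic functions and their primitives *)

Lemma continuous_bounded (f : R -> R) (a b : R) :
  a <= b -> (forall x, continuous f x) ->
  exists M, 0 < M /\ forall x, a <= x <= b -> Rabs (f x) <= M.
Proof.
  intros Hab Hf.
  destruct (continuity_ab_maj (fun x => Rabs (f x)) a b Hab) as [m [Hm _]].
  - intros x _; apply continuous_continuity_pt.
    apply (continuous_comp f Rabs); [apply Hf|apply continuous_Rabs].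
  - exists (Rabs (f m) + 1); split; [pose proof (Rabs_pos (f m)); lra|].
    intros x Hx; specialize (Hm x Hx); simpl in Hm; lra.
Qed.

Lemma periodic1_IZR (f : R -> R) (n : Z) (x : R) : periodic1 f -> f (x + IZR n) = f x.
Proof.
  intros Hf.
  assert (Hn : forall k y, f (y + INR k) = f y).
  { induction k as [|k IH]; intros y.
    - simpl; f_equal; ring.
    - rewrite S_INR, <- Rplus_assoc, Hf; apply IH. }
  destruct (Z_le_gt_dec 0 n) as [h|h].
  - rewrite <- (Z2Nat.id n h), <- INR_IZR_INZ; apply Hn.
  - rewrite <- (Hn (Z.to_nat (- n)) (x + IZR n)).
    rewrite INR_IZR_INZ, Z2Nat.id by lia.
    rewrite opp_IZR; f_equal; ring.
Qed.

Lemma periodic1_bounded (f : R -> R) :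
  periodic1 f -> (forall x, continuous f x) -> exists M, 0 < M /\ forall x, Rabs (f x) <= M.
Proof.
  intros Hp Hf; destruct (continuous_bounded f 0 1 Rle_0_1 Hf) as [M [HM H]].
  exists M; split; [exact HM|]; intros x.
  rewrite <- (periodic1_IZR f (- Int_part x) x Hp).
  apply H; rewrite opp_IZR.
  destruct (base_Int_part x); lra.
Qed.

Lemma derive_bounded_Lipschitz (f f' : R -> R) (M : R) :
  (forall x, is_derive f x (f' x)) -> (forall x, Rabs (f' x) <= M) ->
  forall x y, Rabs (f x - f y) <= M * Rabs (x - y).
Proof.
  intros Df HM x y.
  destruct (MVT_gen f y x f') as [c [_ Hc]].
  - intros z _; apply Df.
  - intros z _; eapply continuous_continuity_pt, is_derive_continuous, Df.
  - rewrite Hc, Rabs_mult; apply Rmult_le_compat_r; [apply Rabs_pos|apply HM].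
Qed.

Lemma is_derive_periodic1 (f f' : R -> R) :
  (forall x, is_derive f x (f' x)) -> periodic1 f -> periodic1 f'.
Proof.
  intros Df Hp x.
  rewrite <- (is_derive_unique f x _ (Df x)).
  symmetry; apply is_derive_unique.
  apply (is_derive_ext (fun y => f (y + 1))); [exact Hp|].
  replace (f' (x + 1)) with (1 * f' (x + 1)) by ring.
  apply (is_derive_comp (V := R_NormedModule) f (fun y => y + 1)); [apply Df|].
  auto_derive; [exact I|ring].
Qed.

Lemma periodic1_C1_Lipschitz (f f' : R -> R) :
  (forall x, is_derive f x (f' x)) -> (forall x, continuous f' x) -> periodic1 f ->
  Lipschitz f.
Proof.
  intros Df Cf Hp.
  destruct (periodic1_bounded f' (is_derive_periodic1 f f' Df Hp) Cf) as [M [_ HM]].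
  exists M; exact (derive_bounded_Lipschitz f f' M Df HM).
Qed.

Lemma is_derive_primitive (f : R -> R) :
  (forall x, continuous f x) -> forall x, is_derive (RInt f 0) x (f x).
Proof.
  intros Cf x; apply (is_derive_RInt f (RInt f 0) 0 x); [|apply Cf].
  apply filter_forall; intros y; apply (RInt_correct (V := R_CompleteNormedModule)), (ex_RInt_continuous (V := R_CompleteNormedModule)).
  intros z _; apply Cf.
Qed.

Lemma ex_RInt_cont (f : R -> R) (a b : R) : (forall x, continuous f x) -> ex_RInt f a b.
Proof.
  intros Cf; apply (ex_RInt_continuous (V := R_CompleteNormedModule)); intros; apply Cf.
Qed.

Lemma RInt_periodic1 (f : R -> R) (x : R) :
  (forall x, continuous f x) -> periodic1 f -> RInt f 0 (x + 1) = RInt f 0 x + RInt f 0 1.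
Proof.
  intros Cf Hp.
  destruct (MVT_gen (fun y => RInt f 0 (y + 1) - RInt f 0 y) 0 x (fun _ => 0)) as [c [_ Hc]].
  - intros y _.
    assert (Hd : is_derive (fun y => RInt f 0 (y + 1) - RInt f 0 y) y (1 * f (y + 1) - f y)).
    { apply (is_derive_minus (V := R_NormedModule) (fun y => RInt f 0 (y + 1)) (RInt f 0));
        [|now apply is_derive_primitive].
      apply (is_derive_comp (V := R_NormedModule) (RInt f 0) (fun y => y + 1));
        [now apply is_derive_primitive|auto_derive; [exact I|ring]]. }
    replace (1 * f (y + 1) - f y) with 0 in Hd by (rewrite Hp; ring); exact Hd.
  - intros y _; apply continuous_continuity_pt.
    apply (continuous_minus (V := R_NormedModule) (fun y => RInt f 0 (y + 1)) (RInt f 0)).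
    + apply (continuous_comp (fun y => y + 1) (RInt f 0)).
      * apply (ex_derive_continuous (V := R_NormedModule)); auto_derive; exact I.
      * eapply is_derive_continuous, is_derive_primitive, Cf.
    + eapply is_derive_continuous, is_derive_primitive, Cf.
  - rewrite RInt_point, Rplus_0_l in Hc.
    unfold zero in Hc; simpl in Hc; lra.
Qed.

(** Subtracting the mean makes the primitive periodic, hence bounded. This is why a corrector with
    gradient [f] gives information on [Hbar] at the mean of [f]. *)
Lemma RInt_periodic1_affine (f : R -> R) :
  (forall x, continuous f x) -> periodic1 f ->
  exists C, forall x, Rabs (RInt f 0 x - RInt f 0 1 * x) <= C.
Proof.
  intros Cf Hp.
  destruct (periodic1_bounded (fun x => RInt f 0 x - RInt f 0 1 * x)) as [C [_ HC]].
  - intros x; rewrite RInt_periodic1 by assumption; ring.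
  - intros x; apply (continuous_minus (V := R_NormedModule) (RInt f 0)).
    + eapply is_derive_continuous, is_derive_primitive, Cf.
    + apply (ex_derive_continuous (V := R_NormedModule)); auto_derive; exact I.
  - now exists C.
Qed.

Lemma unif_cont_linear (th : R) : unif_cont (fun x => th * x).
Proof.
  intros eta Heta; exists (eta / (Rabs th + 1)).
  pose proof (Rabs_pos th) as Hth.
  split; [apply Rdiv_lt_0_compat; lra|].
  intros x y H; apply Rlt_div_r in H; [|lra].
  rewrite <- Rmult_minus_distr_l, Rabs_mult; pose proof (Rabs_pos (x - y)); nra.
Qed.

(** * Bounds on the effective Hamiltonian *)

Section Effective.

Variables G V Hbar : R -> R.
Hypothesis HG : G0 G.
Hypothesis HV : Lipschitz V.
Hypothesis BV : Defs.bounded V.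
Hypothesis Heff : effective_hamiltonian G V Hbar.

Lemma G0_continuous (p : R) : continuous G p.
Proof. apply continuity_pt_filterlim, HG. Qed.

(** The function [th * x + Hbar th * t] solves the limit equation exactly and is smooth, so the two
    comparison lemmas with [a = 0] and zero potential pin [ubar] from both sides. *)
Lemma effective_linear_solution (th : R) (ubar : R -> R -> R) :
  UC_visc_sol 0 (fun _ p => Hbar p) (fun x => th * x) ubar -> ubar 1 0 = Hbar th.
Proof.
  destruct Heff as [CH _]; intros (Hu & Hsub & Hsup & H0).
  assert (CHb : forall p, continuous Hbar p) by (intros p; apply continuity_pt_filterlim, CH).
  assert (Db : forall x, is_derive (fun x => th * x) x th) by (intros x; auto_derive; [exact I|ring]).
  assert (Db' : forall x : R, is_derive (fun _ => th) x 0)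
    by (intros x; apply (is_derive_const (V := R_NormedModule))).
  assert (Cb : forall x : R, continuous (fun _ : R => 0) x) by (intros; apply continuous_const).
  apply Rle_antisym.
  - replace (Hbar th) with (Hbar th * 1 + th * 0) by ring.
    apply (visc_sub_le 0 Hbar (fun _ => 0) ubar (fun x => th * x) (fun _ => th) (fun _ => 0)
             (Hbar th) (Rabs th)); auto; try lra.
    + intros phi t0 x0 Hp Ht Hm; specialize (Hsub phi t0 x0 Hp Ht Hm); simpl in Hsub; lra.
    + intros _; lra.
    + intros _; lra.
    + intros x; rewrite H0; lra.
  - replace (Hbar th) with (Hbar th * 1 + th * 0) by ring.
    apply (visc_super_ge 0 Hbar (fun _ => 0) ubar (fun x => th * x) (fun _ => th) (fun _ => 0)
             (Hbar th) (Rabs th)); auto; try lra.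
    + intros phi t0 x0 Hp Ht Hm; specialize (Hsup phi t0 x0 Hp Ht Hm); simpl in Hsup; lra.
    + intros _; lra.
    + intros _; lra.
    + intros x; rewrite H0; lra.
Qed.

(** The class [G0] writes the diffusion as [sigma ^ 2], so [sigma = sqrt e]; for fixed [e] the
    potential [V (x / e)] is still bounded, and Lipschitz with constant [L / e]. *)
Lemma oscillating_solution (th e : R) :
  0 < e -> exists u, UC_visc_sol e (fun x p => G p + V (x / e)) (fun x => th * x) u.
Proof.
  intros He; destruct HG as (_ & _ & Hwp).
  assert (Hs : sqrt e ^ 2 = e) by (apply pow2_sqrt; lra).
  enough (Hw : well_posed (sqrt e ^ 2) (fun x p => G p + V (x / e))).
  { rewrite Hs in Hw; exact (proj1 (Hw _ (unif_cont_linear th))). }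
  apply (Hwp (sqrt e) (fun x => V (x / e)) (sqrt_pos e)).
  - destruct HV as [L HL]; exists (L / e); intros x y.
    eapply Rle_trans; [apply HL|].
    replace (x / e - y / e) with ((x - y) * / e) by (field; lra).
    rewrite Rabs_mult, (Rabs_pos_eq (/ e)) by (left; now apply Rinv_0_lt_compat).
    right; field; lra.
  - destruct BV as [M HM]; exists M; intros x; apply HM.
Qed.

Lemma effective_limit (th : R) :
  exists u : R -> R -> R -> R,
    (forall e, 0 < e ->
       UC_visc_sol e (fun x p => G p + V (x / e)) (fun x => th * x) (u e)) /\
    forall eta, 0 < eta -> exists d, 0 < d /\
      forall e, 0 < e < d -> Rabs (u e 1 0 - Hbar th) < eta.
Proof.
  destruct (proj2 Heff _ (unif_cont_linear th)) as [ubar [Hubar Hconv]].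
  assert (Hex : forall e, exists u, 0 < e ->
            UC_visc_sol e (fun x p => G p + V (x / e)) (fun x => th * x) u).
  { intros e; destruct (Rlt_dec 0 e) as [h|h].
    - destruct (oscillating_solution th e h) as [u Hu]; exists u; auto.
    (* Filler for [e <= 0], where nothing is required of the family. *)
    - exists (fun _ _ => 0); tauto. }
  pose (u e := proj1_sig (constructive_indefinite_description _ (Hex e))).
  assert (Hu : forall e, 0 < e ->
            UC_visc_sol e (fun x p => G p + V (x / e)) (fun x => th * x) (u e)).
  { intros e; unfold u; apply (proj2_sig (constructive_indefinite_description _ (Hex e))). }
  exists u; split; [exact Hu|].
  intros eta Heta; destruct (Hconv u Hu 1 0 eta Heta) as [d [Hd H]].
  exists d; split; [exact Hd|]; intros e He.
  rewrite <- (effective_linear_solution th ubar Hubar).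
  apply H; try lra. rewrite Rabs_R0; lra.
Qed.

Variables f f' : R -> R.
Hypothesis Df : forall x, is_derive f x (f' x).
Hypothesis Cf' : forall x, continuous f' x.
Hypothesis Pf : periodic1 f.

Let Cf (x : R) : continuous f x.
Proof. eapply is_derive_continuous, Df. Qed.

(** The scaling is chosen so that [e] times the second derivative is exactly [f' (x / e)]: a bound
    on [f' + G(f) + V] carries over to the oscillating equation for every [e]. The constant [c] will
    be [e * C] or its opposite, to order the initial data. *)
Lemma rescaled_corrector_derive (e c : R) :
  0 < e ->
  (forall x, is_derive (fun x => e * RInt f 0 (x / e) + c) x (f (x / e))) /\
  (forall x, is_derive (fun x => f (x / e)) x (f' (x / e) / e)) /\
  (forall x, continuous (fun x => f' (x / e) / e) x).
Proof.
  intros He.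
  assert (Dd : forall x, is_derive (fun x => x / e) x (/ e)).
  { intros x; auto_derive; [exact I|field; lra]. }
  split; [|split]; intros x.
  - replace (f (x / e)) with (e * (/ e * f (x / e)) + 0) by (field; lra).
    apply (is_derive_plus (V := R_NormedModule) (fun x => e * RInt f 0 (x / e)) (fun _ => c));
      [|apply (is_derive_const (V := R_NormedModule))].
    apply (is_derive_scal (fun x => RInt f 0 (x / e))).
    apply (is_derive_comp (V := R_NormedModule) (RInt f 0) (fun x => x / e)); [|apply Dd].
    now apply is_derive_primitive.
  - replace (f' (x / e) / e) with (/ e * f' (x / e)) by (unfold Rdiv; ring).
    apply (is_derive_comp (V := R_NormedModule) f (fun x => x / e)); [apply Df|apply Dd].
  - apply (continuous_mult (K := R_AbsRing) (fun x => f' (x / e)) (fun _ => / e));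
      [|apply continuous_const].
    apply (continuous_comp (fun x => x / e) f'); [|apply Cf'].
    eapply is_derive_continuous, Dd.
Qed.

Lemma rescaled_corrector_initial (C e x : R) :
  0 < e -> (forall x, Rabs (RInt f 0 x - RInt f 0 1 * x) <= C) ->
  e * RInt f 0 (x / e) - e * C <= RInt f 0 1 * x <= e * RInt f 0 (x / e) + e * C.
Proof.
  intros He HC; specialize (HC (x / e)); apply Rabs_le_between in HC.
  replace (RInt f 0 1 * x) with (e * (RInt f 0 1 * (x / e))) by (field; lra).
  nra.
Qed.

(** Comparison up to time 1 gives [u e 1 0 <= lam + e * C], where [e * C] is the cost of replacing
    the linear datum by the rescaled primitive; it vanishes with [e]. *)
Lemma effective_le (lam : R) :
  (forall x, f' x + G (f x) + V x <= lam) -> Hbar (RInt f 0 1) <= lam.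
Proof.
  intros Hlam.
  destruct (periodic1_bounded f Pf Cf) as [M [_ HM]].
  destruct (RInt_periodic1_affine f Cf Pf) as [C HC].
  assert (HC0 : 0 <= C).
  { specialize (HC 0); pose proof (Rabs_pos (RInt f 0 0 - RInt f 0 1 * 0)); lra. }
  destruct (effective_limit (RInt f 0 1)) as [u [Hu Hlim]].
  apply le_epsilon; intros eta Heta.
  destruct (Hlim (eta / 2)) as [d [Hd H]]; [lra|].
  pose (e := Rmin (d / 2) (eta / (2 * (C + 1)))).
  assert (E0 : 0 < e) by (apply Rmin_glb_lt; [lra|apply Rdiv_lt_0_compat; lra]).
  assert (E1 : e <= d / 2) by apply Rmin_l.
  assert (E2 : e <= eta / (2 * (C + 1))) by apply Rmin_r.
  apply Rle_div_r in E2; [|lra].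
  specialize (H e ltac:(lra)); apply Rabs_def2 in H.
  destruct (Hu e E0) as (U1 & U2 & _ & U0).
  destruct (rescaled_corrector_derive e (e * C) E0) as (D1 & D2 & D3).
  assert (Hle : u e 1 0 <= lam * 1 + (e * RInt f 0 (0 / e) + e * C)).
  { apply (visc_sub_le e G (fun x => V (x / e)) (u e) (fun x => e * RInt f 0 (x / e) + e * C)
             (fun x => f (x / e)) (fun x => f' (x / e) / e) lam M); eauto using G0_continuous; try lra.
    - intros x; replace (e * (f' (x / e) / e)) with (f' (x / e)) by (field; lra); apply Hlam.
    - intros x; rewrite U0; now apply rescaled_corrector_initial. }
  unfold Rdiv in Hle at 1; rewrite Rmult_0_l, RInt_point in Hle.
  unfold zero in Hle; simpl in Hle; lra.
Qed.

Lemma effective_ge (lam : R) :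
  (forall x, lam <= f' x + G (f x) + V x) -> lam <= Hbar (RInt f 0 1).
Proof.
  intros Hlam.
  destruct (periodic1_bounded f Pf Cf) as [M [_ HM]].
  destruct (RInt_periodic1_affine f Cf Pf) as [C HC].
  assert (HC0 : 0 <= C).
  { specialize (HC 0); pose proof (Rabs_pos (RInt f 0 0 - RInt f 0 1 * 0)); lra. }
  destruct (effective_limit (RInt f 0 1)) as [u [Hu Hlim]].
  apply le_epsilon; intros eta Heta.
  destruct (Hlim (eta / 2)) as [d [Hd H]]; [lra|].
  pose (e := Rmin (d / 2) (eta / (2 * (C + 1)))).
  assert (E0 : 0 < e) by (apply Rmin_glb_lt; [lra|apply Rdiv_lt_0_compat; lra]).
  assert (E1 : e <= d / 2) by apply Rmin_l.
  assert (E2 : e <= eta / (2 * (C + 1))) by apply Rmin_r.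
  apply Rle_div_r in E2; [|lra].
  specialize (H e ltac:(lra)); apply Rabs_def2 in H.
  destruct (Hu e E0) as (U1 & _ & U2 & U0).
  destruct (rescaled_corrector_derive e (- (e * C)) E0) as (D1 & D2 & D3).
  assert (Hle : lam * 1 + (e * RInt f 0 (0 / e) + - (e * C)) <= u e 1 0).
  { apply (visc_super_ge e G (fun x => V (x / e)) (u e)
             (fun x => e * RInt f 0 (x / e) + - (e * C))
             (fun x => f (x / e)) (fun x => f' (x / e) / e) lam M); eauto using G0_continuous; try lra.
    - intros x; replace (e * (f' (x / e) / e)) with (f' (x / e)) by (field; lra); apply Hlam.
    - intros x; rewrite U0; now apply rescaled_corrector_initial. }
  unfold Rdiv in Hle at 1; rewrite Rmult_0_l, RInt_point in Hle.
  unfold zero in Hle; simpl in Hle; lra.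
Qed.

End Effective.

(** * Elementary integral estimates *)

Lemma RInt_le_const (h : R -> R) (a b c : R) :
  a <= b -> (forall x, continuous h x) -> (forall x, a < x < b -> h x <= c) ->
  RInt h a b <= c * (b - a).
Proof.
  intros Hab Ch Hh.
  replace (c * (b - a)) with (RInt (fun _ => c) a b)
    by (rewrite RInt_const; unfold scal; simpl; unfold mult; simpl; ring).
  apply RInt_le; auto using ex_RInt_cont.
  apply ex_RInt_cont; intros; apply continuous_const.
Qed.

Lemma RInt_ge_const (h : R -> R) (a b c : R) :
  a <= b -> (forall x, continuous h x) -> (forall x, a < x < b -> c <= h x) ->
  c * (b - a) <= RInt h a b.
Proof.
  intros Hab Ch Hh.
  replace (c * (b - a)) with (RInt (fun _ => c) a b)
    by (rewrite RInt_const; unfold scal; simpl; unfold mult; simpl; ring).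
  apply RInt_le; auto using ex_RInt_cont.
  apply ex_RInt_cont; intros; apply continuous_const.
Qed.

Lemma RInt_le_transition (h : R -> R) (l a b r nu M : R) :
  (forall x, continuous h x) -> l <= a -> a <= b -> b <= r ->
  (forall x, l < x < a -> h x <= - nu) -> (forall x, b < x < r -> h x <= - nu) ->
  (forall x, a < x < b -> h x <= M) ->
  RInt h l r <= - nu * (r - l) + (M + nu) * (b - a).
Proof.
  intros Ch La Lb Lr H1 H2 H3.
  rewrite <- (RInt_Chasles h l a r), <- (RInt_Chasles h a b r) by (apply ex_RInt_cont, Ch).
  unfold plus; simpl.
  pose proof (RInt_le_const h l a _ La Ch H1).
  pose proof (RInt_le_const h a b _ Lb Ch H3).
  pose proof (RInt_le_const h b r _ Lr Ch H2).
  lra.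
Qed.

(** * The balanced profile *)

(** It matters that [rho] does not depend on the level [c]: the steepness [N] is fixed from [rho]
    before the intermediate value theorem selects [c]. The worst levels are near the extrema, where
    the cosine is flat, whence the quadratic size of [rho]. *)
Lemma cos_short_transition (e : R) :
  0 < e -> exists rho, 0 < rho /\ forall c, exists a b,
    0 <= a /\ a <= b /\ b <= 1 / 2 /\ b - a <= e /\
    forall x, 0 <= x <= 1 / 2 ->
      (x < a -> c + rho < cos (2 * PI * x)) /\ (b < x -> cos (2 * PI * x) < c - rho).
Proof.
  intros He.
  pose proof PI_RGT_0 as Hpi; pose proof PI2_1 as Hpi1.
  pose (e0 := Rmin e 1).
  assert (He0 : 0 < e0) by (apply Rmin_glb_lt; lra).
  assert (He1 : e0 <= e) by apply Rmin_l.
  assert (He2 : e0 <= 1) by apply Rmin_r.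
  assert (Hs0 : 0 < sin e0) by (apply sin_gt_0; lra).
  exists (sin e0 * sin e0); split; [nra|]; intros c.
  set (rho := sin e0 * sin e0).
  assert (Hrho : 0 < rho) by (unfold rho; nra).
  (* The levels [c + rho] and [c - rho] may leave the range of the cosine; clamping then puts the
     endpoint at [0] or [1 / 2]. *)
  pose (clamp y := Rmax (- 1) (Rmin 1 y)).
  assert (Hcl : forall y, - 1 <= clamp y <= 1).
  { intros y; unfold clamp; split; [apply Rmax_l|].
    apply Rmax_lub; [lra|apply Rmin_l]. }
  set (al := acos (clamp (c + rho))); set (be := acos (clamp (c - rho))).
  assert (Ca : cos al = clamp (c + rho)) by (apply cos_acos, Hcl).
  assert (Cb : cos be = clamp (c - rho)) by (apply cos_acos, Hcl).
  assert (Ba : 0 <= al <= PI) by apply acos_bound.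
  assert (Bb : 0 <= be <= PI) by apply acos_bound.
  assert (Hdiff : 0 <= cos al - cos be <= 2 * rho).
  { rewrite Ca, Cb; unfold clamp, Rmax, Rmin.
    repeat destruct Rle_dec; lra. }
  assert (Hab : al <= be).
  { apply Rnot_lt_le; intros h.
    pose proof (cos_decreasing_1 be al ltac:(lra) ltac:(lra) ltac:(lra) ltac:(lra) h); lra. }
  set (de := (be - al) / 2).
  assert (Hde : de <= e0).
  { apply Rnot_lt_le; intros h.
    assert (S1 : sin e0 < sin de) by (apply sin_increasing_1; unfold de in *; lra).
    assert (S2 : sin de <= sin ((al + be) / 2)).
    { destruct (Rle_dec ((al + be) / 2) (PI / 2)) as [k|k].
      - apply sin_incr_1; unfold de; lra.
      - rewrite <- (sin_PI_x ((al + be) / 2)).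
        apply sin_incr_1; unfold de; lra. }
    (* With midpoint between [de] and [PI - de], this product is at least [2 * sin de ^ 2], so a
       long transition would exceed the allowed drop [2 * rho]. *)
    assert (S3 : cos al - cos be = 2 * sin ((al + be) / 2) * sin de).
    { rewrite form2. unfold de.
      replace ((al - be) / 2) with (- ((be - al) / 2)) by field.
      rewrite sin_neg; ring. }
    assert (rho < sin de * sin de) by (unfold rho; nra).
    assert (sin de * sin de <= sin ((al + be) / 2) * sin de)
      by (apply Rmult_le_compat_r; lra).
    lra. }
  exists (al / (2 * PI)), (be / (2 * PI)).
  split; [apply Rdiv_le_0_compat; lra|].
  split; [apply Rmult_le_compat_r; [left; apply Rinv_0_lt_compat; lra|lra]|].
  split; [apply Rle_div_l; lra|].
  split.
  { replace (be / (2 * PI) - al / (2 * PI)) with (de / PI) by (unfold de; field; lra).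
    apply Rle_div_l; nra. }
  intros x Hx; split; intros Hlt.
  - apply Rlt_div_r in Hlt; [|lra].
    assert (Hc : cos al < cos (2 * PI * x)) by (apply cos_decreasing_1; nra).
    rewrite Ca in Hc. pose proof (COS_bound (2 * PI * x)).
    unfold clamp, Rmax, Rmin in Hc; repeat destruct Rle_dec; lra.
  - apply Rlt_div_l in Hlt; [|lra].
    assert (Hc : cos (2 * PI * x) < cos be) by (apply cos_decreasing_1; nra).
    rewrite Cb in Hc. pose proof (COS_bound (2 * PI * x)).
    unfold clamp, Rmax, Rmin in Hc; repeat destruct Rle_dec; lra.
Qed.

Definition logistic (p1 p2 y : R) : R := p1 + (p2 - p1) / (1 + exp (- y)).

Lemma logistic_bounds (p1 p2 y : R) :
  p1 < p2 -> p1 <= logistic p1 p2 y <= p2 /\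
  logistic p1 p2 y - p1 <= (p2 - p1) * exp y /\
  p2 - logistic p1 p2 y <= (p2 - p1) * exp (- y).
Proof.
  intros Hp; unfold logistic.
  pose proof (exp_pos y) as E1; pose proof (exp_pos (- y)) as E2.
  assert (E3 : exp y * exp (- y) = 1) by (rewrite <- exp_plus, Rplus_opp_r; apply exp_0).
  set (v := / (1 + exp (- y))).
  assert (Hv : v * (1 + exp (- y)) = 1) by (unfold v; field; lra).
  assert (Hv0 : 0 < v) by (apply Rinv_0_lt_compat; lra).
  unfold Rdiv; fold v.
  assert (Hv1 : v <= 1) by nra.
  assert (Hv2 : v <= exp y).
  { replace v with (exp y * (exp (- y) * v)) by (rewrite <- Rmult_assoc, E3; ring). nra. }
  assert (Hv3 : 1 - v <= exp (- y)) by nra.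
  repeat split; nra.
Qed.

Lemma logistic_tails (p1 p2 r : R) :
  p1 < p2 -> 0 < r -> exists L, 0 < L /\ forall y,
    (y <= - L -> Rabs (logistic p1 p2 y - p1) < r) /\
    (L <= y -> Rabs (logistic p1 p2 y - p2) < r).
Proof.
  intros Hp Hr.
  set (t := r / (2 * (p2 - p1))).
  assert (Ht : 0 < t) by (apply Rdiv_lt_0_compat; lra).
  assert (Htr : (p2 - p1) * t = r / 2) by (unfold t; field; lra).
  exists (Rabs (ln t) + 1); pose proof (Rabs_pos (ln t)) as Hln.
  split; [lra|].
  pose proof (Rabs_maj2 (ln t)) as Hl.
  assert (Hexp : forall z, z <= - (Rabs (ln t) + 1) -> (p2 - p1) * exp z < r).
  { intros z Hz; assert (exp z < t); [|nra].
    rewrite <- (exp_ln t Ht); apply exp_increasing; lra. }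
  intros y; destruct (logistic_bounds p1 p2 y Hp) as (B1 & B2 & B3).
  split; intros Hy.
  - specialize (Hexp y Hy); apply Rabs_def1; lra.
  - specialize (Hexp (- y) ltac:(lra)); apply Rabs_def1; lra.
Qed.

Lemma continuous_logistic (p1 p2 y : R) : continuous (logistic p1 p2) y.
Proof.
  apply (ex_derive_continuous (V := R_NormedModule)); unfold logistic; auto_derive.
  pose proof (exp_pos (- y)); lra.
Qed.

Lemma continuous_cos_shift (N c x : R) : continuous (fun x => N * (cos (2 * PI * x) - c)) x.
Proof. apply (ex_derive_continuous (V := R_NormedModule)); auto_derive; exact I. Qed.

Lemma continuous_RInt_cos_shift (psi : R -> R) (N : R) :
  (forall y, continuous psi y) ->
  forall c, continuous (fun c => RInt (fun x => psi (N * (cos (2 * PI * x) - c))) 0 1) c.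
Proof.
  intros Cpsi c; apply eps_continuous; intros e He.
  assert (Cc : forall c x, continuous (fun x => psi (N * (cos (2 * PI * x) - c))) x).
  { intros c' x; apply (continuous_comp (fun x => N * (cos (2 * PI * x) - c')) psi);
      [apply continuous_cos_shift|apply Cpsi]. }
  set (K := Rabs N * (Rabs c + 2)).
  destruct (Heine_cor2 (f := psi) (a := - K) (b := K)
              (fun x _ => continuous_continuity_pt _ _ (Cpsi x)) (mkposreal (e / 2) ltac:(lra)))
    as [d Hd]; simpl in Hd.
  pose proof (Rabs_pos N) as HN; pose proof (cond_pos d) as Hd0.
  exists (Rmin 1 (d / (Rabs N + 1))); split.
  { apply Rmin_glb_lt; [lra|apply Rdiv_lt_0_compat; lra]. }
  intros c' Hc'.
  assert (H1 : Rabs (c' - c) < 1) by (eapply Rlt_le_trans; [exact Hc'|apply Rmin_l]).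
  assert (H2 : Rabs (c' - c) < d / (Rabs N + 1)) by (eapply Rlt_le_trans; [exact Hc'|apply Rmin_r]).
  apply Rlt_div_r in H2; [|lra].
  assert (HK : forall x z, Rabs (z - c) <= 1 -> - K <= N * (cos (2 * PI * x) - z) <= K).
  { intros x z Hz; apply Rabs_le_between; unfold K; rewrite Rabs_mult.
    apply Rmult_le_compat_l; [exact HN|].
    pose proof (COS_bound (2 * PI * x)) as Hcos.
    apply Rabs_le_between in Hz.
    pose proof (Rle_abs c); pose proof (Rle_abs (- c)) as Hc2; rewrite Rabs_Ropp in Hc2.
    apply Rabs_le_between; lra. }
  replace (RInt _ 0 1 - RInt _ 0 1) with
    (RInt (fun x => psi (N * (cos (2 * PI * x) - c')) - psi (N * (cos (2 * PI * x) - c))) 0 1).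
  - eapply Rle_lt_trans; [apply (abs_RInt_le_const _ 0 1 (e / 2)); [lra| |]|lra].
    + apply ex_RInt_cont; intros x.
      apply (continuous_minus (V := R_NormedModule)); apply Cc.
    + intros x _; left; apply Hd; try (apply HK).
      * lra.
      * rewrite Rminus_eq_0, Rabs_R0; lra.
      * replace (N * (cos (2 * PI * x) - c') - N * (cos (2 * PI * x) - c))
          with (N * - (c' - c)) by ring.
        rewrite Rabs_mult, Rabs_Ropp; pose proof (Rabs_pos (c' - c)); nra.
  - apply (RInt_minus (V := R_CompleteNormedModule)); apply ex_RInt_cont; apply Cc.
Qed.

Lemma cos_2PI_periodic1 (x : R) : cos (2 * PI * (x + 1)) = cos (2 * PI * x).
Proof.
  replace (2 * PI * (x + 1)) with (2 * PI * x + 2 * INR 1 * PI) by (simpl; ring).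
  apply cos_period.
Qed.

Lemma cos_2PI_reflect (x : R) : cos (2 * PI * (1 - x)) = cos (2 * PI * x).
Proof.
  rewrite <- (cos_neg (2 * PI * x)).
  replace (- (2 * PI * x)) with (2 * PI * (- x)) by ring.
  rewrite <- (cos_2PI_periodic1 (- x)); f_equal; ring.
Qed.

(* The profile is a logistic function of [N (cos (2 PI x) - c)]: for large [N] it stays near [p1] or [p2] except on two short intervals, and [c] is tuned by the intermediate value theorem. *)
Lemma balanced_profile (D k : R -> R) (p1 p2 : R) :
  p1 < p2 -> (forall p, continuous D p) -> (forall p, continuous k p) ->
  D p1 < 0 -> 0 < D p2 -> k p1 < 0 -> k p2 < 0 ->
  exists f f' f'' : R -> R,
    (forall x, is_derive f x (f' x)) /\ (forall x, is_derive f' x (f'' x)) /\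
    (forall x, continuous f'' x) /\ periodic1 f /\ (forall x, p1 <= f x <= p2) /\
    RInt (fun x => D (f x)) 0 1 = 0 /\ RInt (fun x => k (f x)) 0 1 < 0.
Proof.
  intros Hp CD Ck D1 D2 k1 k2.
  destruct (continuous_eps D p1 (CD p1) (- D p1 / 2) ltac:(lra)) as [r1 [R1 HD1]].
  destruct (continuous_eps D p2 (CD p2) (D p2 / 2) ltac:(lra)) as [r2 [R2 HD2]].
  destruct (continuous_eps k p1 (Ck p1) (- k p1 / 2) ltac:(lra)) as [r3 [R3 Hk1]].
  destruct (continuous_eps k p2 (Ck p2) (- k p2 / 2) ltac:(lra)) as [r4 [R4 Hk2]].
  pose (r := Rmin (Rmin r1 r2) (Rmin r3 r4)).
  assert (Hr : 0 < r) by (repeat apply Rmin_glb_lt; assumption).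
  assert (Hr12 : r <= r1 /\ r <= r2).
  { split; (eapply Rle_trans; [apply Rmin_l|]); [apply Rmin_l|apply Rmin_r]. }
  assert (Hr34 : r <= r3 /\ r <= r4).
  { split; (eapply Rle_trans; [apply Rmin_r|]); [apply Rmin_l|apply Rmin_r]. }
  pose (nu := Rmin (- k p1 / 2) (- k p2 / 2)).
  assert (Hnu : 0 < nu) by (apply Rmin_glb_lt; lra).
  assert (Hnu1 : nu <= - k p1 / 2) by apply Rmin_l.
  assert (Hnu2 : nu <= - k p2 / 2) by apply Rmin_r.
  destruct (continuous_bounded k p1 p2 (Rlt_le _ _ Hp) Ck) as [M [HM HMk]].
  destruct (logistic_tails p1 p2 r Hp Hr) as [L [HL Htail]].
  (* There are two transitions per period, each costing at most [(M + nu) * (b - a) <= nu / 4],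
     against a total gain of [nu]. *)
  destruct (cos_short_transition (nu / (4 * (M + nu)))) as [rho [Hrho Htrans]].
  { apply Rdiv_lt_0_compat; lra. }
  set (N := L / rho).
  assert (HN : N * rho = L) by (unfold N; field; lra).
  assert (HN0 : 0 < N) by (apply Rdiv_lt_0_compat; lra).
  pose (F c x := logistic p1 p2 (N * (cos (2 * PI * x) - c))).
  assert (Flow : forall c x, cos (2 * PI * x) <= c - rho -> Rabs (F c x - p1) < r).
  { intros c x H; apply Htail; nra. }
  assert (Fhigh : forall c x, c + rho <= cos (2 * PI * x) -> Rabs (F c x - p2) < r).
  { intros c x H; apply Htail; nra. }
  assert (CF : forall c x, continuous (F c) x).
  { intros c x; apply (continuous_comp (fun x => N * (cos (2 * PI * x) - c)) (logistic p1 p2));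
      [apply continuous_cos_shift|apply continuous_logistic]. }
  assert (CDF : forall c x, continuous (fun x => D (F c x)) x).
  { intros c x; apply (continuous_comp (F c) D); [apply CF|apply CD]. }
  assert (CkF : forall c x, continuous (fun x => k (F c x)) x).
  { intros c x; apply (continuous_comp (F c) k); [apply CF|apply Ck]. }
  pose (J c := RInt (fun x => D (F c x)) 0 1).
  (* For [c = 1 + rho] the whole profile lies near [p1], for [c = - 1 - rho] near [p2]; hence the
     sign change. *)
  assert (J1 : J (1 + rho) < 0).
  { eapply Rle_lt_trans; [apply (RInt_le_const _ 0 1 (D p1 / 2)); [lra|apply CDF|]|lra].
    intros x _; pose proof (COS_bound (2 * PI * x)).
    specialize (HD1 (F (1 + rho) x)); apply Rabs_def2 in HD1; [lra|].
    eapply Rlt_le_trans; [apply Flow; lra|lra]. }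
  assert (J2 : 0 < J (- 1 - rho)).
  { eapply Rlt_le_trans; [|apply (RInt_ge_const _ 0 1 (D p2 / 2)); [lra|apply CDF|]]; [lra|].
    intros x _; pose proof (COS_bound (2 * PI * x)).
    specialize (HD2 (F (- 1 - rho) x)); apply Rabs_def2 in HD2; [lra|].
    eapply Rlt_le_trans; [apply Fhigh; lra|lra]. }
  destruct (IVT_cor J (- 1 - rho) (1 + rho)) as [c [_ Hc]].
  - intros c; apply continuous_continuity_pt.
    apply (continuous_RInt_cos_shift (fun y => D (logistic p1 p2 y)) N).
    intros y; apply (continuous_comp (logistic p1 p2) D); [apply continuous_logistic|apply CD].
  - lra.
  - nra.
  - pose (e x := exp (- (N * (cos (2 * PI * x) - c)))).
    pose (f' x := - (p2 - p1) * (e x * (N * (2 * PI) * sin (2 * PI * x))) / (1 + e x) ^ 2).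
    assert (He : forall x, 0 < e x) by (intros; apply exp_pos).
    pose (f'' x := - (p2 - p1) * (N * (2 * PI)) *
            (2 * PI * cos (2 * PI * x) * e x / (1 + e x) ^ 2 +
             N * (2 * PI) * sin (2 * PI * x) ^ 2 * e x * (1 - e x) / (1 + e x) ^ 3)).
    exists (F c), f', f''.
    assert (De : forall x, is_derive e x (N * (2 * PI) * sin (2 * PI * x) * e x)).
    { intros x; unfold e; auto_derive; [exact I|].
      unfold Rminus; ring. }
    assert (Df : forall x, is_derive (F c) x (f' x)).
    { intros x; specialize (He x).
      change (is_derive (fun x => p1 + (p2 - p1) / (1 + e x)) x (f' x)).
      unfold f'; clearbody e; auto_derive; [split; [eexists; apply De|split; [lra|exact I]]|].
      rewrite (is_derive_unique (fun x : R => e x) x _ (De x)); field; lra. }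
    assert (Df' : forall x, is_derive f' x (f'' x)).
    { intros x; specialize (He x); unfold f', f''; clearbody e; auto_derive.
      - repeat split; first [eexists; apply De|apply Rgt_not_eq; nra].
      - rewrite (is_derive_unique (fun x : R => e x) x _ (De x)).
        field; lra. }
    split; [exact Df|]. split; [exact Df'|].
    split; [|split; [|split; [|split]]].
    + intros x; specialize (He x); apply (ex_derive_continuous (V := R_NormedModule)).
      unfold f''; clearbody e; auto_derive; repeat split;
        first [eexists; apply De|apply Rgt_not_eq; repeat apply Rmult_lt_0_compat; lra].
    + intros x; unfold F; now rewrite cos_2PI_periodic1.
    + intros x; now apply logistic_bounds.
    + exact Hc.
    + destruct (Htrans c) as (a & b & Ha & Hab & Hb & Hba & Hx).
      apply Rle_div_r in Hba; [|lra].
      assert (Hgood : forall x y, 0 <= y <= 1 / 2 -> cos (2 * PI * x) = cos (2 * PI * y) ->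
                        y < a \/ b < y -> k (F c x) <= - nu).
      { intros x y Hy Hxy Hor; destruct (Hx y Hy) as [X1 X2].
        rewrite <- Hxy in X1, X2.
        destruct Hor as [h|h].
        - assert (HF : Rabs (F c x - p2) < r4).
          { eapply Rlt_le_trans; [apply Fhigh; specialize (X1 h); lra|lra]. }
          specialize (Hk2 _ HF); apply Rabs_def2 in Hk2; lra.
        - assert (HF : Rabs (F c x - p1) < r3).
          { eapply Rlt_le_trans; [apply Flow; specialize (X2 h); lra|lra]. }
          specialize (Hk1 _ HF); apply Rabs_def2 in Hk1; lra. }
      assert (Hbd : forall x, k (F c x) <= M).
      { intros x; assert (HF : p1 <= F c x <= p2) by now apply logistic_bounds.
        specialize (HMk _ HF); apply Rabs_le_between in HMk; lra. }
      (* The cosine is monotone on each half period, and the reflection [x -> 1 - x] turns the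
         transition [[a, b]] into [[1 - b, 1 - a]]. *)
      rewrite <- (RInt_Chasles _ 0 (1 / 2) 1) by (apply ex_RInt_cont, CkF).
      unfold plus; simpl.
      pose proof (RInt_le_transition (fun x => k (F c x)) 0 a b (1 / 2) nu M (CkF c)) as I1.
      pose proof (RInt_le_transition (fun x => k (F c x)) (1 / 2) (1 - b) (1 - a) 1 nu M (CkF c))
        as I2.
      assert (I1' : RInt (fun x => k (F c x)) 0 (1 / 2) <= - nu * (1 / 2 - 0) + (M + nu) * (b - a)).
      { apply I1; auto; intros x Hx'; apply (Hgood x x); auto; lra. }
      assert (I2' : RInt (fun x => k (F c x)) (1 / 2) 1
                    <= - nu * (1 - 1 / 2) + (M + nu) * ((1 - a) - (1 - b))).
      { apply I2; auto; try lra; intros x Hx'; apply (Hgood x (1 - x)); try lra;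
          now rewrite cos_2PI_reflect. }
      lra.
Qed.

(** Lagrange remainder by Rolle: [h] takes the value [G (x + q)] at both 0 and 1. Parametrizing the
    segment by [[0, 1]] covers [q] of either sign and [q = 0] at once. *)
Lemma taylor_order2 (G D E : R -> R) (x q : R) :
  (forall p, is_derive G p (D p)) -> (forall p, is_derive D p (E p)) ->
  exists xi, Rabs (xi - x) <= Rabs q /\ G (x + q) = G x + D x * q + E xi / 2 * (q * q).
Proof.
  intros DG DD.
  pose (K := G (x + q) - G x - q * D x).
  pose (h t := G (x + t * q) + (1 - t) * q * D (x + t * q) + (1 - t) * (1 - t) * K).
  pose (h' t := (1 - t) * (q * q * E (x + t * q) - 2 * K)).
  assert (Dh : forall t, is_derive h t (h' t)).
  { intros t; unfold h, h'.
    assert (DGt : is_derive (fun t => G (x + t * q)) t (q * D (x + t * q))).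
    { apply (is_derive_comp (V := R_NormedModule) G (fun t => x + t * q)); [apply DG|].
      auto_derive; [exact I|ring]. }
    assert (DDt : is_derive (fun t => D (x + t * q)) t (q * E (x + t * q))).
    { apply (is_derive_comp (V := R_NormedModule) D (fun t => x + t * q)); [apply DD|].
      auto_derive; [exact I|ring]. }
    auto_derive.
    - repeat split; eexists; [apply DG|apply DD].
    - rewrite (is_derive_unique (fun y : R => G y) _ _ (DG _)), (is_derive_unique (fun y : R => D y) _ _ (DD _)).
      ring. }
  destruct (MVT_cor2 h h' 0 1 Rlt_0_1) as [t [Ht1 Ht2]].
  { intros t _; apply is_derive_Reals, Dh. }
  exists (x + t * q); split.
  - replace (x + t * q - x) with (t * q) by ring.
    rewrite Rabs_mult, (Rabs_pos_eq t) by lra; pose proof (Rabs_pos q); nra.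
  - unfold h, h' in Ht1.
    replace (x + 1 * q) with (x + q) in Ht1 by ring.
    replace (x + 0 * q) with x in Ht1 by ring.
    assert (H0 : (1 - t) * (q * q * E (x + t * q) - 2 * K) = 0) by (unfold K in *; lra).
    apply Rmult_integral in H0; destruct H0 as [H0|H0]; [lra|].
    unfold K in H0; lra.
Qed.

(** The two requirements read [- k1 / d1 < mu < - k2 / d2]; the last hypothesis says that this
    interval is nonempty, and its midpoint is taken. *)
Lemma multiplier_exists (k1 k2 d1 d2 : R) :
  d1 < 0 -> 0 < d2 -> k1 * d2 < k2 * d1 -> exists mu, k1 + mu * d1 < 0 /\ k2 + mu * d2 < 0.
Proof.
  intros H1 H2 H; exists ((- k1 / d1 - k2 / d2) / 2); split.
  - replace (k1 + _) with ((k1 * d2 - k2 * d1) / (2 * d2)) by (field; lra).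
    apply Rlt_div_l; lra.
  - replace (k2 + _) with (- ((k2 * d1 - k1 * d2) / (2 * - d1))) by (field; lra).
    assert (0 < (k2 * d1 - k1 * d2) / (2 * - d1)) by (apply Rdiv_lt_0_compat; lra). lra.
Qed.

Lemma exp_monotone (x y : R) : x <= y -> exp x <= exp y.
Proof. intros [H| ->]; [left; now apply exp_increasing|right; reflexivity]. Qed.

(** * Perturbed correctors *)

Section Perturbation.

Variables G D E : R -> R.
Hypothesis DG : forall p, is_derive G p (D p).
Hypothesis DD : forall p, is_derive D p (E p).
Hypothesis CE : forall p, continuous E p.

Variables f f' : R -> R.
Hypothesis Df : forall x, is_derive f x (f' x).
Hypothesis Cf' : forall x, continuous f' x.
Hypothesis Pf : periodic1 f.
Hypothesis If : RInt (fun x => D (f x)) 0 1 = 0.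

Let Cf (x : R) : continuous f x.
Proof. eapply is_derive_continuous, Df. Qed.

Let CDf (x : R) : continuous (fun x => D (f x)) x.
Proof.
  apply (continuous_comp f D); [apply Cf|eapply is_derive_continuous, DD].
Qed.

Let CEf (x : R) : continuous (fun x => E (f x)) x.
Proof. apply (continuous_comp f E); [apply Cf|apply CE]. Qed.

(* The periodic solution of the linearized corrector equation [phi' + G'(f) phi = 0]. *)
Definition linearized (x : R) : R := exp (- RInt (fun x => D (f x)) 0 x).

Lemma linearized_pos (x : R) : 0 < linearized x.
Proof. apply exp_pos. Qed.

Lemma is_derive_linearized (x : R) : is_derive linearized x (- D (f x) * linearized x).
Proof.
  apply (is_derive_comp (V := R_NormedModule) exp (fun x => - RInt (fun x => D (f x)) 0 x)).
  - apply is_derive_exp.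
  - apply (is_derive_opp (V := R_NormedModule)), (is_derive_primitive (fun x => D (f x)) CDf).
Qed.

Lemma continuous_linearized (x : R) : continuous linearized x.
Proof. eapply is_derive_continuous, is_derive_linearized. Qed.

(** Here the mean-zero condition [If] enters: it makes the exponent periodic. *)
Lemma linearized_periodic1 : periodic1 linearized.
Proof.
  intros x; unfold linearized; rewrite RInt_periodic1, If, Rplus_0_r; auto.
  intros y; now rewrite Pf.
Qed.

Lemma linearized_bounds (K x : R) :
  (forall x, Rabs (D (f x)) <= K) -> 0 <= x <= 1 -> exp (- K) <= linearized x <= exp K.
Proof.
  intros HK Hx.
  assert (H : Rabs (RInt (fun x => D (f x)) 0 x) <= K).
  { pose proof (Rle_trans _ _ _ (Rabs_pos _) (HK 0)) as HK0.
    apply (Rle_trans _ ((x - 0) * K)); [|nra].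
    apply abs_RInt_le_const; [lra|apply ex_RInt_cont, CDf|intros; apply HK]. }
  apply Rabs_le_between in H.
  split; apply exp_monotone; lra.
Qed.

(* With [phi] the linearized corrector and [z' = - E(f) phi / 2 - de], the function [f + s phi + s^2 phi z] cancels the terms of order [s] and leaves [- de phi s^2] at order [s^2]; the mean of [z'] vanishes exactly when [de] is minus half the integral of [E(f) phi]. *)
Lemma perturbed_correctors :
  RInt (fun x => E (f x) * linearized x) 0 1 < 0 ->
  exists m n c s0, 0 < m /\ 0 < c /\ 0 < s0 /\
    forall s, Rabs s < s0 -> exists g g' : R -> R,
      (forall x, is_derive g x (g' x)) /\ (forall x, continuous g' x) /\ periodic1 g /\
      RInt g 0 1 = RInt f 0 1 + s * (m + s * n) /\
      forall x, g' x + G (g x) <= f' x + G (f x) - c * (s * s).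
Proof.
  intros Hneg.
  set (phi := linearized).
  set (de := - / 2 * RInt (fun x => E (f x) * phi x) 0 1).
  assert (Hde : 0 < de) by (unfold de, phi; lra).
  set (zd := fun x => - / 2 * (E (f x) * phi x) - de).
  assert (CEphi : forall x, continuous (fun x => E (f x) * phi x) x).
  { intros x; apply (continuous_mult (K := R_AbsRing) (fun x => E (f x)) phi);
      [apply CEf|apply continuous_linearized]. }
  assert (Czd : forall x, continuous zd x).
  { intros x; apply (continuous_minus (V := R_NormedModule) _ (fun _ => de));
      [|apply continuous_const].
    apply (continuous_scal_r (V := R_NormedModule) (- / 2) (fun x => E (f x) * phi x)), CEphi. }
  set (z := RInt zd 0).
  assert (Dz : forall x, is_derive z x (zd x)) by (apply is_derive_primitive, Czd).
  assert (Cz : forall x, continuous z x) by (intros x; eapply is_derive_continuous, Dz).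
  assert (Pz : periodic1 z).
  { intros x; unfold z; rewrite RInt_periodic1; auto.
    - replace (RInt zd 0 1) with 0; [ring|].
      symmetry; apply is_RInt_unique; unfold zd.
      replace 0 with (- / 2 * RInt (fun x => E (f x) * phi x) 0 1 - (1 - 0) * de) at 2
        by (unfold de; ring).
      apply (is_RInt_minus (V := R_NormedModule)).
      + apply (is_RInt_scal (V := R_NormedModule)).
        apply (RInt_correct (V := R_CompleteNormedModule)), ex_RInt_cont, CEphi.
      + apply (is_RInt_const (V := R_NormedModule)).
    - intros y; unfold zd, phi; now rewrite Pf, linearized_periodic1. }
  destruct (periodic1_bounded f Pf Cf) as [Mf [Mf0 HMf]].
  destruct (periodic1_bounded z Pz Cz) as [Z [Z0 HZ]].
  destruct (periodic1_bounded phi linearized_periodic1 continuous_linearized) as [Ph [Ph0 HPh]].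
  destruct (periodic1_bounded (fun x => / phi x)) as [Pi [Pi0 HPi]].
  { intros x; unfold phi; now rewrite linearized_periodic1. }
  { intros x; apply (continuous_Rinv_comp phi); [apply continuous_linearized|].
    apply Rgt_not_eq, linearized_pos. }
  destruct (continuous_bounded E (- (Mf + 1)) (Mf + 1) ltac:(lra) CE) as [ME [ME0 HME]].
  (* Two errors of size [eta] will occur, one from the modulus of [E], one from the factor
     [(1 + s z)^2]. After multiplication by [phi / 2] they consume at most half of [de]. *)
  set (eta := de / (2 * Ph)).
  assert (Heta : 0 < eta) by (apply Rdiv_lt_0_compat; lra).
  assert (HetaPh : eta * Ph = de / 2) by (unfold eta; field; lra).
  destruct (Heine_cor2 (f := E) (a := - (Mf + 1)) (b := Mf + 1)
              (fun x _ => continuous_continuity_pt _ _ (CE x)) (mkposreal eta Heta))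
    as [d Hd]; simpl in Hd.
  pose proof (cond_pos d) as Hd0.
  assert (Hlin : forall x, 0 < phi x <= Ph).
  { intros x; split; [apply linearized_pos|].
    specialize (HPh x); apply Rabs_le_between in HPh; lra. }
  (* [Pi] is here a bound for [/ phi], so the surviving decrease [phi * de / 2] is at least the
     third constant. *)
  exists (RInt phi 0 1), (RInt (fun x => phi x * z x) 0 1), (de / (2 * Pi)).
  (* The three bounds give [Rabs (1 + s z) <= 1 + Z], then [Rabs q < Rmin 1 d], which keeps the
     Taylor point in the compact interval and within the modulus, and finally the [eta] bound on the
     error from [(1 + s z)^2]. *)
  set (s0 := Rmin (Rmin 1 (Rmin 1 d / (Ph * (1 + Z)))) (eta / (ME * (2 * Z + Z * Z)))).
  assert (S0 : 0 < s0).
  { assert (0 < Rmin 1 d) by (apply Rmin_glb_lt; lra).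
    repeat apply Rmin_glb_lt; try lra; apply Rdiv_lt_0_compat; nra. }
  exists s0.
  assert (Cphiz : forall x, continuous (fun x => phi x * z x) x).
  { intros x; apply (continuous_mult (K := R_AbsRing) phi z);
      [apply continuous_linearized|apply Cz]. }
  split; [|split; [|split]].
  - apply (Rlt_le_trans _ (/ Pi * (1 - 0))); [rewrite Rminus_0_r, Rmult_1_r; now apply Rinv_0_lt_compat|].
    apply RInt_ge_const; [lra|apply continuous_linearized|].
    intros x _; destruct (Hlin x) as [h _].
    specialize (HPi x); rewrite Rabs_pos_eq in HPi by (left; now apply Rinv_0_lt_compat).
    rewrite <- (Rinv_inv (phi x)); apply Rinv_le_contravar; [now apply Rinv_0_lt_compat|exact HPi].
  - apply Rdiv_lt_0_compat; lra.
  - exact S0.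
  - intros s Hs.
    assert (S1 : Rabs s < 1).
    { eapply Rlt_le_trans; [exact Hs|]; eapply Rle_trans; [apply Rmin_l|apply Rmin_l]. }
    assert (S2 : Rabs s < Rmin 1 d / (Ph * (1 + Z))).
    { eapply Rlt_le_trans; [exact Hs|]; eapply Rle_trans; [apply Rmin_l|apply Rmin_r]. }
    assert (S3 : Rabs s < eta / (ME * (2 * Z + Z * Z))).
    { eapply Rlt_le_trans; [exact Hs|apply Rmin_r]. }
    apply Rlt_div_r in S2; [|nra]. apply Rlt_div_r in S3; [|nra].
    pose proof (Rabs_pos s) as S4.
    exists (fun x => f x + (s * phi x + s * s * (phi x * z x))).
    exists (fun x => f' x + (s * (- D (f x) * phi x)
              + s * s * (- D (f x) * phi x * z x + phi x * zd x))).
    split; [|split; [|split; [|split]]].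
    + intros x; apply (is_derive_plus (V := R_NormedModule)); [apply Df|].
      apply (is_derive_plus (V := R_NormedModule)).
      * apply (is_derive_scal phi), is_derive_linearized.
      * apply (is_derive_scal (fun x => phi x * z x)).
        apply (is_derive_mult phi z);
          [apply is_derive_linearized|apply Dz|intros; apply Rmult_comm].
    + assert (CDphi : forall x, continuous (fun x => - D (f x) * phi x) x).
      { intros x; apply (continuous_mult (K := R_AbsRing) (fun x => - D (f x)) phi);
          [apply (continuous_opp (V := R_NormedModule)), CDf|apply continuous_linearized]. }
      intros x; apply (continuous_plus (V := R_NormedModule)); [apply Cf'|].
      apply (continuous_plus (V := R_NormedModule)).
      * apply (continuous_scal_r (V := R_NormedModule) s (fun x => - D (f x) * phi x)), CDphi.
      * apply (continuous_scal_r (V := R_NormedModule) (s * s)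
                 (fun x => - D (f x) * phi x * z x + phi x * zd x)).
        apply (continuous_plus (V := R_NormedModule)).
        -- apply (continuous_mult (K := R_AbsRing) (fun x => - D (f x) * phi x) z);
             [apply CDphi|apply Cz].
        -- apply (continuous_mult (K := R_AbsRing) phi zd);
             [apply continuous_linearized|apply Czd].
    + intros x; unfold phi; now rewrite Pf, Pz, linearized_periodic1.
    + apply is_RInt_unique.
      replace (RInt f 0 1 + s * (RInt phi 0 1 + s * RInt (fun x => phi x * z x) 0 1)) with
        (RInt f 0 1 + (s * RInt phi 0 1 + s * s * RInt (fun x => phi x * z x) 0 1)) by ring.
      apply (is_RInt_plus (V := R_NormedModule));
        [|apply (is_RInt_plus (V := R_NormedModule)); apply (is_RInt_scal (V := R_NormedModule))];
        apply (RInt_correct (V := R_CompleteNormedModule)), ex_RInt_cont; auto.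
      apply continuous_linearized.
    + intros x.
      set (q := s * phi x + s * s * (phi x * z x)).
      destruct (Hlin x) as [P1 P2].
      pose proof (HZ x) as Zx; pose proof (HMf x) as Fx.
      assert (Hsz : Rabs (s * z x) <= Rabs s * Z).
      { rewrite Rabs_mult; apply Rmult_le_compat_l; [exact S4|exact Zx]. }
      assert (Hq : Rabs q < Rmin 1 d).
      { replace q with (s * (phi x * (1 + s * z x))) by (unfold q; ring).
        eapply Rle_lt_trans; [|exact S2].
        rewrite Rabs_mult; apply Rmult_le_compat_l; [exact S4|].
        rewrite Rabs_mult, (Rabs_pos_eq (phi x)) by lra.
        apply Rmult_le_compat; [lra|apply Rabs_pos|exact P2|].
        apply Rabs_le_between in Hsz; apply Rabs_le_between; nra. }
      destruct (taylor_order2 G D E (f x) q DG DD) as [xi [Hxi HT]].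
      rewrite HT.
      assert (Q1 : Rabs (xi - f x) < 1).
      { eapply Rle_lt_trans; [exact Hxi|]; eapply Rlt_le_trans; [exact Hq|apply Rmin_l]. }
      assert (Q2 : Rabs (xi - f x) < d).
      { eapply Rle_lt_trans; [exact Hxi|]; eapply Rlt_le_trans; [exact Hq|apply Rmin_r]. }
      apply Rabs_def2 in Q1; apply Rabs_le_between in Fx.
      specialize (Hd xi (f x) ltac:(lra) ltac:(lra) Q2).
      specialize (HME xi ltac:(lra)).
      set (y := s * z x) in *.
      assert (Hy : Rabs (2 * y + y * y) <= Rabs s * (2 * Z + Z * Z)).
      { replace (2 * y + y * y) with (y * (2 + y)) by ring.
        rewrite Rabs_mult.
        replace (Rabs s * (2 * Z + Z * Z)) with (Rabs s * Z * (2 + Z)) by ring.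
        apply Rmult_le_compat; try apply Rabs_pos; [exact Hsz|].
        eapply Rle_trans; [apply Rabs_triang|].
        rewrite (Rabs_pos_eq 2) by lra; nra. }
      assert (HEy : Rabs (E xi * (2 * y + y * y)) <= eta).
      { rewrite Rabs_mult.
        apply (Rle_trans _ (ME * (Rabs s * (2 * Z + Z * Z)))); [|lra].
        apply Rmult_le_compat; try apply Rabs_pos; assumption. }
      apply Rabs_def2 in Hd; apply Rabs_le_between in HEy.
      assert (Hmain : phi x * (E xi * (1 + y) * (1 + y) - E (f x)) <= de).
      { assert (Hb : E xi * (1 + y) * (1 + y) - E (f x) <= 2 * eta).
        { replace (E xi * (1 + y) * (1 + y) - E (f x)) with
            ((E xi - E (f x)) + E xi * (2 * y + y * y)) by ring; lra. }
        apply (Rle_trans _ (phi x * (2 * eta))); [apply Rmult_le_compat_l; lra|nra]. }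
      assert (Hc : de / (2 * Pi) <= phi x * de / 2).
      { assert (HPx : 1 <= phi x * Pi).
        { specialize (HPi x); rewrite Rabs_pos_eq in HPi by (left; now apply Rinv_0_lt_compat).
          replace 1 with (phi x * / phi x) by (field; lra).
          apply Rmult_le_compat_l; lra. }
        apply Rle_div_l; nra. }
      (* The contributions of [D (f x) * q] cancel against the derivative of [phi], at order [s] and
         at order [s^2]; only [zd] and the Taylor remainder are left. *)
      replace (f' x + (s * (- D (f x) * phi x) + s * s * (- D (f x) * phi x * z x + phi x * zd x))
               + (G (f x) + D (f x) * q + E xi / 2 * (q * q)))
        with (f' x + G (f x) + s * s * phi x *
               (- de + phi x * (E xi * (1 + y) * (1 + y) - E (f x)) / 2))
        by (unfold q, zd, y; field).
      assert (s * s * phi x * (- de + phi x * (E xi * (1 + y) * (1 + y) - E (f x)) / 2)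
              <= s * s * phi x * (- de / 2)).
      { apply Rmult_le_compat_l; [|lra]. apply Rmult_le_pos; [nra|lra]. }
      assert (s * s * (de / (2 * Pi)) <= s * s * (phi x * de / 2))
        by (apply Rmult_le_compat_l; [nra|exact Hc]).
      lra.
Qed.

End Perturbation.

(** * Construction of the potential and failure of quasiconvexity *)

Theorem theorem2p1 (G : R -> R) (p1 p2 K1 : R) :
  C2 G -> G0 G ->
  p1 < p2 ->
  Derive G p1 < 0 -> 0 < Derive G p2 ->
  (exists p, p1 <= p <= p2 /\ K1 = Rabs (Derive G p)) ->
  (forall p, p1 <= p <= p2 -> Rabs (Derive G p) <= K1) ->
  Derive (Derive G) p1 < 0 ->
  Derive (Derive G) p1 * Derive G p2 * exp (- K1)
    < Derive (Derive G) p2 * Derive G p1 * exp K1 ->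
  exists V : R -> R,
    Lipschitz V /\ periodic1 V /\
    forall Hbar, effective_hamiltonian G V Hbar -> ~ quasiconvex Hbar.
Proof.
  intros HC2 HG0 Hp Hd1 Hd2 _ HK He1 Hcond.
  set (D := Derive G) in *; set (E := Derive D) in *.
  assert (DG : forall p, is_derive G p (D p)) by (intros p; apply Derive_correct, HC2).
  assert (DD : forall p, is_derive D p (E p)) by (intros p; apply Derive_correct, HC2).
  assert (CE : forall p, continuous E p) by (intros p; apply HC2).
  assert (CD : forall p, continuous D p) by (intros p; eapply is_derive_continuous, DD).
  pose (k0 p := Rmax (E p * exp (- K1)) (E p * exp K1)).
  assert (HK0 : 0 <= K1).
  { eapply Rle_trans; [apply Rabs_pos|apply (HK p1); lra]. }
  pose proof (exp_pos (- K1)) as X1; pose proof (exp_pos K1) as X2.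
  assert (X3 : exp (- K1) <= exp K1) by (apply exp_monotone; lra).
  destruct (multiplier_exists (k0 p1) (k0 p2) (D p1) (D p2)) as [mu [Hmu1 Hmu2]]; auto.
  (* As [E p1 < 0], the maximum at [p1] is the [exp (- K1)] term. If the maximum at [p2] is the
     [exp K1] term, the claim is the hypothesis; otherwise [E p2 < 0] and the two sides have
     opposite signs. *)
  { unfold k0; rewrite Rmax_left by nra.
    unfold Rmax; destruct Rle_dec as [h|h]; [lra|].
    assert (E p2 < 0) by (apply Rnot_le_lt in h; nra).
    assert (0 < - E p1 * exp (- K1) * D p2) by (repeat apply Rmult_lt_0_compat; lra).
    assert (0 < - E p2 * exp (- K1) * - D p1) by (repeat apply Rmult_lt_0_compat; lra).
    lra. }
  pose (k p := k0 p + mu * D p).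
  assert (Ck : forall p, continuous k p).
  { intros p; apply (continuous_plus (V := R_NormedModule)).
    - apply (continuous_ext (fun p => (E p * exp (- K1) + E p * exp K1
               + Rabs (E p * exp (- K1) - E p * exp K1)) / 2)).
      + intros t; simpl; unfold k0, Rmax; destruct Rle_dec;
          [rewrite Rabs_left1 by lra|rewrite Rabs_pos_eq by lra]; field.
      + assert (Cs : forall a, continuous (fun p => E p * a) p).
        { intros a; apply (continuous_mult (K := R_AbsRing) E (fun _ => a));
            [apply CE|apply continuous_const]. }
        apply (continuous_mult (K := R_AbsRing) _ (fun _ => / 2)); [|apply continuous_const].
        apply (continuous_plus (V := R_NormedModule)).
        * apply (continuous_plus (V := R_NormedModule)); apply Cs.
        * apply (continuous_comp (fun p => E p * exp (- K1) - E p * exp K1) Rabs);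
            [|apply continuous_Rabs].
          apply (continuous_minus (V := R_NormedModule)); apply Cs.
    - apply (continuous_scal_r (V := R_NormedModule) mu D), CD. }
  destruct (balanced_profile D k p1 p2 Hp CD Ck Hd1 Hd2 Hmu1 Hmu2)
    as (f & f' & f'' & Df & Df' & Cf'' & Pf & Bf & If & Ik).
  assert (Cf : forall x, continuous f x) by (intros x; eapply is_derive_continuous, Df).
  assert (Cf' : forall x, continuous f' x) by (intros x; eapply is_derive_continuous, Df').
  assert (Hneg : RInt (fun x => E (f x) * linearized D f x) 0 1 < 0).
  { assert (CEphi : forall x, continuous (fun x => E (f x) * linearized D f x) x).
    { intros x; apply (continuous_mult (K := R_AbsRing) (fun x => E (f x)) (linearized D f)).
      - apply (continuous_comp f E); [apply Cf|apply CE].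
      - eapply continuous_linearized; eauto. }
    assert (CDf : forall x, continuous (fun x => D (f x)) x)
      by (intros x; apply (continuous_comp f D); [apply Cf|apply CD]).
    assert (CmuD : forall x, continuous (fun x => mu * D (f x)) x)
      by (intros x; apply (continuous_scal_r (V := R_NormedModule) mu (fun x => D (f x))), CDf).
    (* Adding [mu * D (f x)] is free because of [If], and makes the integrand comparable pointwise
       with [k (f x)]. *)
    replace (RInt (fun x => E (f x) * linearized D f x) 0 1) with
      (RInt (fun x => E (f x) * linearized D f x + mu * D (f x)) 0 1).
    - eapply Rle_lt_trans; [|exact Ik].
      apply RInt_le; [lra| | |].
      + apply ex_RInt_cont; intros x; apply (continuous_plus (V := R_NormedModule)); auto.
      + apply ex_RInt_cont; intros x; apply (continuous_comp f k); auto.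
      + intros x Hx; unfold k, k0; apply Rplus_le_compat_r.
        destruct (linearized_bounds D E DD f f' Df K1 x) as [L1 L2]; [intros; apply HK, Bf|lra|].
        destruct (Rle_dec 0 (E (f x))).
        * eapply Rle_trans; [|apply Rmax_r]; nra.
        * eapply Rle_trans; [|apply Rmax_l]; nra.
    - rewrite (RInt_plus (V := R_CompleteNormedModule)) by (apply ex_RInt_cont; auto).
      rewrite (RInt_scal (V := R_CompleteNormedModule)) by (apply ex_RInt_cont; auto).
      rewrite If; unfold plus, scal; simpl; unfold mult; simpl; ring. }
  destruct (perturbed_correctors G D E DG DD CE f f' Df Cf' Pf If Hneg)
    as (m & n & c & s0 & Hm & Hc & Hs0 & Hpert).
  pose (V x := - (f' x + G (f x))).
  assert (DV : forall x, is_derive V x (- (f'' x + f' x * D (f x)))).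
  { intros x; apply (is_derive_opp (V := R_NormedModule)).
    apply (is_derive_plus (V := R_NormedModule)); [apply Df'|].
    apply (is_derive_comp (V := R_NormedModule) G f); [apply DG|apply Df]. }
  assert (CV : forall x, continuous V x) by (intros x; eapply is_derive_continuous, DV).
  assert (PV : periodic1 V).
  { intros x; unfold V; now rewrite Pf, (is_derive_periodic1 f f' Df Pf). }
  (* [V] contains [f'], which is why the profile was built with a continuous second derivative. *)
  assert (LV : Lipschitz V).
  { apply (periodic1_C1_Lipschitz V _ DV); [|exact PV].
    intros x; apply (continuous_opp (V := R_NormedModule)).
    apply (continuous_plus (V := R_NormedModule)); [apply Cf''|].
    apply (continuous_mult (K := R_AbsRing) f' (fun x => D (f x))); [apply Cf'|].
    apply (continuous_comp f D); [apply Cf|apply CD]. }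
  assert (BV : Defs.bounded V).
  { destruct (periodic1_bounded V PV CV) as [M [_ HM]]; now exists M. }
  exists V; split; [exact LV|split; [exact PV|]].
  intros Hbar Heff Hqc.
  assert (H0 : 0 <= Hbar (RInt f 0 1)).
  { apply (effective_ge G V Hbar HG0 LV BV Heff f f' Df Cf' Pf 0).
    intros x; unfold V; lra. }
  (* The second bound gives [Rabs (s * n) < m], so the means for [s] and [- s] lie strictly on
     opposite sides of the mean of [f]. *)
  pose (s := Rmin (s0 / 2) (m / (2 * (Rabs n + 1)))).
  pose proof (Rabs_pos n) as Hn.
  assert (Hs : 0 < s) by (apply Rmin_glb_lt; [lra|apply Rdiv_lt_0_compat; lra]).
  assert (Hs1 : s <= s0 / 2) by apply Rmin_l.
  assert (Hs2 : s <= m / (2 * (Rabs n + 1))) by apply Rmin_r.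
  apply Rle_div_r in Hs2; [|lra].
  assert (Hsn : - m < s * n < m).
  { apply Rabs_lt_between; rewrite Rabs_mult, (Rabs_pos_eq s) by lra; nra. }
  assert (Hneighbour : forall t, Rabs t < s0 ->
            Hbar (RInt f 0 1 + t * (m + t * n)) <= - (c * (t * t))).
  { intros t Ht; destruct (Hpert t Ht) as (g & g' & Dg & Cg & Pg & Ig & Hg).
    rewrite <- Ig.
    apply (effective_le G V Hbar HG0 LV BV Heff g g' Dg Cg Pg).
    intros x; specialize (Hg x); unfold V; lra. }
  assert (Hr : Hbar (RInt f 0 1 + s * (m + s * n)) <= - (c * (s * s))).
  { apply Hneighbour; rewrite Rabs_pos_eq; lra. }
  assert (Hl : Hbar (RInt f 0 1 + - s * (m + - s * n)) <= - (c * (s * s))).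
  { replace (s * s) with (- s * - s) by ring.
    apply Hneighbour; rewrite Rabs_Ropp, Rabs_pos_eq; lra. }
  assert (0 < s * (m + s * n)) by (apply Rmult_lt_0_compat; lra).
  assert (0 < s * (m - s * n)) by (apply Rmult_lt_0_compat; lra).
  assert (Hmid : Hbar (RInt f 0 1) <= - (c * (s * s))).
  { refine (Hqc _ _ _ _ _ _ Hl Hr); lra. }
  assert (0 < c * (s * s)) by (repeat apply Rmult_lt_0_compat; lra).
  lra.
Qed.
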